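(* Let $\mathbf{B}_1\in\mathbb{H}^{r\times s}_{r_1}$, $\mathbf{A}_2\in\mathbb{H}^{m\times p}_{r_2}$, $\mathbf{B}_2\in\mathbb{H}^{q\times s}_{r_3}$, $\mathbf{C}\in\mathbb{H}^{m\times s}$, let $\mathbf{N}=\mathbf{B}_2\mathbf{L}_{B_1}$ with $\operatorname{rank}\mathbf{N}=r_4$. Let $\mathbf{X}_1=\mathbf{C}\mathbf{B}_1^\dagger-\mathbf{Q}_{A_2}\mathbf{C}\mathbf{N}^\dagger\mathbf{B}_2\mathbf{B}_1^\dagger=(x^{(1)}_{ij})\in\mathbb{H}^{m\times r}$ and $\mathbf{X}_2=\mathbf{A}_2^\dagger\mathbf{C}\mathbf{N}^\dagger=(x^{(2)}_{gf})\in\mathbb{H}^{p\times q}$. Let $\ddot{\mathbf{a}}^{(2)}_{i.}$ be the $i$th row of $\mathbf{A}_2\mathbf{A}_2^*$; $\mathbf{c}^{(1)}_{i.}$ and $\mathbf{c}^{(2)}_{l.}$ the $i$th row of $\mathbf{C}_1=\mathbf{C}\mathbf{B}_1^*$ and the $l$th row of $\mathbf{C}_2=\mathbf{C}\mathbf{N}^*$; $\tilde{\mathbf{b}}^{(2)}_{t.}$ the $t$th row of $\tilde{\mathbf{B}}_2=\mathbf{B}_2\mathbf{B}_1^*$; and $\mathbf{c}^{(3)}_{.l}$, $\mathbf{c}^{(3)}_{k.}$ the $l$th column and $k$th row of $\mathbf{C}_3=\mathbf{A}_2^*\mathbf{C}\mathbf{N}^*$. Then $$x^{(1)}_{ij}=\frac{\sum_{\alpha\in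 I_{r_1,r}\{j\}}\mathrm{rdet}_j\big((\mathbf{B}_1\mathbf{B}_1^* )_{j.}(\mathbf{c}^{(1)}_{i.})\big)^\alpha_\alpha}{\sum_{\alpha\in I_{r_1,r}}|\mathbf{B}_1\mathbf{B}_1^*|^\alpha_\alpha}-\frac{\sum_{l=1}^m\sum_{t=1}^q x^{(11)}_{il}x^{(12)}_{lt}x^{(13)}_{tj}}{\sum_{\alpha\in I_{r_2,m}}|\mathbf{A}_2\mathbf{A}_2^*|^\alpha_\alpha\sum_{\alpha\in I_{r_4,q}}|\mathbf{N}\mathbf{N}^*|^\alpha_\alpha\sum_{\alpha\in I_{r_1,r}}|\mathbf{B}_1\mathbf{B}_1^*|^\alpha_\alpha},$$ where $x^{(11)}_{il}=\sum_{\alpha\in I_{r_2,m}\{l\}}\mathrm{rdet}_l\big((\mathbf{A}_2\mathbf{A}_2^* )_{l.}(\ddot{\mathbf{a}}^{(2)}_{i.})\big)^\alpha_\alpha$, $x^{(12)}_{lt}=\sum_{\alpha\in I_{r_4,q}\{t\}}\mathrm{rdet}_t\big((\mathbf{N}\mathbf{N}^* )_{t.}(\mathbf{c}^{(2)}_{l.})\big)^\alpha_\alpha$, $x^{(13)}_{tj}=\sum_{\alpha\in I_{r_1,r}\{j\}}\mathrm{rdet}_j\big((\mathbf{B}_1\mathbf{B}_1^* )_{j.}(\tilde{\mathbf{b}}^{(2)}_{t.})\big)^\alpha_\alpha$; and $$x^{(2)}_{gf}=\frac{\sum_{\alpha\in I_{r_4,q}\{f\}}\mathrm{rdet}_f\big((\mathbf{N}\mathbf{N}^*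 )_{f.}(\mathbf{d}^{A_2}_{g.})\big)^\alpha_\alpha}{\sum_{\beta\in J_{r_2,p}}|\mathbf{A}_2^*\mathbf{A}_2|^\beta_\beta\sum_{\alpha\in I_{r_4,q}}|\mathbf{N}\mathbf{N}^*|^\alpha_\alpha}=\frac{\sum_{\beta\in J_{r_2,p}\{g\}}\mathrm{cdet}_g\big((\mathbf{A}_2^*\mathbf{A}_2)_{.g}(\mathbf{d}^{N}_{.f})\big)^\beta_\beta}{\sum_{\beta\in J_{r_2,p}}|\mathbf{A}_2^*\mathbf{A}_2|^\beta_\beta\sum_{\alpha\in I_{r_4,q}}|\mathbf{N}\mathbf{N}^*|^\alpha_\alpha},$$ where $\mathbf{d}^{A_2}_{g.}\in\mathbb{H}^{1\times q}$ has $l$th entry $\sum_{\beta\in J_{r_2,p}\{g\}}\mathrm{cdet}_g\big((\mathbf{A}_2^*\mathbf{A}_2)_{.g}(\mathbf{c}^{(3)}_{.l})\big)^\beta_\beta$ ($l=1,\dots,q$) and $\mathbf{d}^{N}_{.f}\in\mathbb{H}^{p\times1}$ has $k$th entry $\sum_{\alpha\in I_{r_4,q}\{f\}}\mathrm{rdet}_f\big((\mathbf{N}\mathbf{N}^* )_{f.}(\mathbf{c}^{(3)}_{k.})\big)^\alpha_\alpha$ ($k=1,\dots,p$).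
   Context: $\mathbb{H}$ is the skew field of real quaternions; $\mathbb{H}^{m\times n}$ is the set of $m\times n$ matrices over $\mathbb{H}$ and $\mathbb{H}^{m\times n}_r$ the subset of those of rank $r$. $\mathbf{A}^*$ is the conjugate transpose and $\mathbf{A}^\dagger$ the Moore–Penrose inverse (the unique $\mathbf{X}$ with $\mathbf{AXA}=\mathbf{A}$, $\mathbf{XAX}=\mathbf{X}$, $(\mathbf{AX})^*=\mathbf{AX}$, $(\mathbf{XA})^*=\mathbf{XA}$). $\mathbf{L}_A=\mathbf{I}-\mathbf{A}^\dagger\mathbf{A}$, $\mathbf{Q}_A=\mathbf{A}\mathbf{A}^\dagger$. For a matrix $\mathbf{F}$, $\mathbf{F}_{.j}(\mathbf{b})$ (resp. $\mathbf{F}_{i.}(\mathbf{b})$) is $\mathbf{F}$ with its $j$th column (resp. $i$th row) replaced by the column (resp. row) $\mathbf{b}$. Row/column determinants: for $\mathbf{F}=(a_{ij})\in\mathbb{H}^{n\times n}$, $\mathrm{rdet}_i\mathbf{F}=\sum_{\sigma\in S_n}(-1)^{n-r}(a_{i\,i_{k_1}}a_{i_{k_1}i_{k_1+1}}\cdots a_{i_{k_1+l_1}i})\cdots(a_{i_{k_r}i_{k_r+1}}\cdots a_{i_{k_r+l_r}i_{k_r}})$, where $\sigma=(i\,i_{k_1}\,i_{k_1+1}\cdots i_{k_1+l_1})(i_{k_2}\cdots i_{k_2+l_2})\cdots(i_{k_r}\cdots i_{k_r+l_r})$ is the decomposition of $\sigma$ into $r$ disjoint cycles (fixed points included) with $i_{k_2}<\cdots<i_{k_r}$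 and $i_{k_t}<i_{k_t+s}$ for $t=2,\dots,r$, $s=1,\dots,l_t$; and $\mathrm{cdet}_j\mathbf{F}=\sum_{\tau\in S_n}(-1)^{n-r}(a_{j_{k_r}j_{k_r+l_r}}\cdots a_{j_{k_r+1}j_{k_r}})\cdots(a_{j\,j_{k_1+l_1}}\cdots a_{j_{k_1+1}j_{k_1}}a_{j_{k_1}j})$, where $\tau=(j_{k_r+l_r}\cdots j_{k_r+1}\,j_{k_r})\cdots(j_{k_2+l_2}\cdots j_{k_2})(j_{k_1+l_1}\cdots j_{k_1+1}\,j_{k_1}\,j)$ is the decomposition into $r$ disjoint cycles with $j_{k_2}<\cdots<j_{k_r}$ and $j_{k_t}<j_{k_t+s}$ for $t=2,\dots,r$, $s=1,\dots,l_t$. For Hermitian $\mathbf{F}$ all these coincide and are real; this value is $\det\mathbf{F}$. Index sets: $L_{k,n}$ is the set of strictly increasing sequences $\alpha=(\alpha_1<\cdots<\alpha_k)$ in $\{1,\dots,n\}$; $I_{k,m}\{i\}=\{\alpha\in L_{k,m}: i\in\alpha\}$, $J_{k,n}\{j\}=\{\beta\in L_{k,n}: j\in\beta\}$; sums over $J_{k,n}$ or $I_{k,m}$ without braces run over all of $L_{k,n}$, $L_{k,m}$. For a square $\mathbf{F}$, $\mathbf{F}^\alpha_\alpha$ is the principal submatrix with rows and columns indexed by $\alpha$; $\mathrm{cdet}_i(\mathbf{G})^\beta_\beta$ (resp. $\mathrm{rdet}_j(\mathbf{G})^\alpha_\alpha$) is the column (resp. row) determinant of the principal submatrix $\mathbf{G}^\beta_\beta$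 taken at the column (resp. row) coming from index $i$ (resp. $j$); for Hermitian $\mathbf{F}$, $|\mathbf{F}|^\alpha_\alpha=\det\mathbf{F}^\alpha_\alpha$. *)

(* Defs.v *)
From HB Require Import structures.
From mathcomp Require Import all_boot all_order all_algebra all_fingroup.
From mathcomp Require Import reals.
From mathcomp Require Import ring.
Set Implicit Arguments. Unset Strict Implicit. Unset Printing Implicit Defensive.
Import Order.TTheory GRing.Theory Num.Theory.
Local Open Scope ring_scope.

Section Quaternion.
Variable R : realType.

Record quat := Quat { q0 : R; q1 : R; q2 : R; q3 : R }.

Definition quat2prod (x : quat) := (q0 x, q1 x, q2 x, q3 x).
Definition prod2quat (p : R * R * R * R) :=
  let: (a, b, c, d) := p in Quat a b c d.
Lemma quat2prodK : cancel quat2prod prod2quat. Proof. by case. Qed.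

HB.instance Definition _ := Equality.copy quat (can_type quat2prodK).
HB.instance Definition _ := Choice.copy quat (can_type quat2prodK).

Definition qzero := Quat 0 0 0 0.
Definition qone := Quat 1 0 0 0.
Definition qadd x y := Quat (q0 x + q0 y) (q1 x + q1 y) (q2 x + q2 y) (q3 x + q3 y).
Definition qopp x := Quat (- q0 x) (- q1 x) (- q2 x) (- q3 x).
(* Hamilton product: i^2 = j^2 = k^2 = ijk = -1 *)
Definition qmul x y := Quat
  (q0 x * q0 y - q1 x * q1 y - q2 x * q2 y - q3 x * q3 y)
  (q0 x * q1 y + q1 x * q0 y + q2 x * q3 y - q3 x * q2 y)
  (q0 x * q2 y - q1 x * q3 y + q2 x * q0 y + q3 x * q1 y)
  (q0 x * q3 y + q1 x * q2 y - q2 x * q1 y + q3 x * q0 y).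

Lemma quat_eq (x y : quat) :
  q0 x = q0 y -> q1 x = q1 y -> q2 x = q2 y -> q3 x = q3 y -> x = y.
Proof. by case: x => ????; case: y => ???? /= -> -> -> ->. Qed.

Lemma qaddA : associative qadd.
Proof. by move=> x y z; apply: quat_eq => /=; ring. Qed.
Lemma qaddC : commutative qadd.
Proof. by move=> x y; apply: quat_eq => /=; ring. Qed.
Lemma qadd0 : left_id qzero qadd.
Proof. by move=> x; apply: quat_eq => /=; ring. Qed.
Lemma qaddN : left_inverse qzero qopp qadd.
Proof. by move=> x; apply: quat_eq => /=; ring. Qed.

HB.instance Definition _ := GRing.isZmodule.Build quat qaddA qaddC qadd0 qaddN.

Lemma qmulA : associative qmul.
Proof. by move=> x y z; apply: quat_eq => /=; ring. Qed.
Lemma qmul1 : left_id qone qmul.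
Proof. by move=> x; apply: quat_eq => /=; ring. Qed.
Lemma qmulr1 : right_id qone qmul.
Proof. by move=> x; apply: quat_eq => /=; ring. Qed.
Lemma qmulDl : left_distributive qmul qadd.
Proof. by move=> x y z; apply: quat_eq => /=; ring. Qed.
Lemma qmulDr : right_distributive qmul qadd.
Proof. by move=> x y z; apply: quat_eq => /=; ring. Qed.
Lemma qone_neq0 : qone != qzero.
Proof. by apply/eqP => -[]; apply/eqP; rewrite oner_eq0. Qed.

HB.instance Definition _ :=
  GRing.Zmodule_isNzRing.Build quat qmulA qmul1 qmulr1 qmulDl qmulDr qone_neq0.

(* quaternion conjugation and inverse (inverse of 0 is 0) *)
Definition qconj x := Quat (q0 x) (- q1 x) (- q2 x) (- q3 x).
Definition qnorm2 x := q0 x ^+ 2 + q1 x ^+ 2 + q2 x ^+ 2 + q3 x ^+ 2.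
Definition qinv x := let n := (qnorm2 x)^-1 in
  Quat (q0 x * n) (- q1 x * n) (- q2 x * n) (- q3 x * n).

End Quaternion.


Section QMatrix.
Variable R : realType.
Local Notation H := (quat R).

Definition adjq m n (A : 'M[H]_(m, n)) : 'M[H]_(n, m) :=
  \matrix_(i, j) qconj (A j i).

Definition is_MPinv m n (A : 'M[H]_(m, n)) (X : 'M[H]_(n, m)) : Prop :=
  [/\ A *m X *m A = A, X *m A *m X = X,
      adjq (A *m X) = A *m X & adjq (X *m A) = X *m A].

Definition indep_cols m n k (A : 'M[H]_(m, n)) (f : 'I_k -> 'I_n) : Prop :=
  injective f /\ forall v : 'cV[H]_k, colsub f A *m v = 0 -> v = 0.

Definition has_rankq m n (A : 'M[H]_(m, n)) (r : nat) : Prop :=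
  (exists f : 'I_r -> 'I_n, indep_cols A f) /\
  (forall k (f : 'I_k -> 'I_n), indep_cols A f -> (k <= r)%N).

Definition rowrep m n (F : 'M[H]_(m, n)) (i : 'I_m) (b : 'rV[H]_n) :=
  \matrix_(a, c) if a == i then b 0 c else F a c.
Definition colrep m n (F : 'M[H]_(m, n)) (j : 'I_n) (c : 'cV[H]_m) :=
  \matrix_(a, b) if b == j then c a 0 else F a b.

Definition cycprod n (A : 'M[H]_n) (s : 'S_n) (x : 'I_n) : H :=
  \prod_(t < #|porbit s x|) A ((s ^+ t)%g x) ((s ^+ t.+1)%g x).

Definition cycleader n (s : 'S_n) (x : 'I_n) : bool :=
  [forall y in porbit s x, (x <= y)%N].

(* rdet_i: cycle through i first, then the other cycles, each started
   at its least element, in increasing order of these elements;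
   sign (-1)^(n - r), r = number of cycles (fixed points included) *)
Definition rdet n (i : 'I_n) (A : 'M[H]_n) : H :=
  \sum_(s : 'S_n) (-1) ^+ (n - #|porbits s|) *
     (cycprod A s i *
      \prod_(x < n | cycleader s x && (x \notin porbit s i)) cycprod A s x).

(* cdet_j: other cycles (each started at its least element) in
   decreasing order of these elements, the cycle through j last *)
Definition cdet n (j : 'I_n) (A : 'M[H]_n) : H :=
  \sum_(s : 'S_n) (-1) ^+ (n - #|porbits s|) *
     ((\prod_(x <- rev (enum 'I_n) | cycleader s x && (x \notin porbit s j))
         cycprod A s x) * cycprod A s j).

(* row/column determinant at the position (as a natural number) p;
   0 if p is out of range (never happens below) *)
Definition rdet_at n (p : nat) (A : 'M[H]_n) : H :=
  if [pick x : 'I_n | val x == p] is Some x then rdet x A else 0.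
Definition cdet_at n (p : nat) (A : 'M[H]_n) : H :=
  if [pick x : 'I_n | val x == p] is Some x then cdet x A else 0.

(* determinant of a Hermitian matrix (all rdet_i, cdet_j coincide);
   the 0x0 determinant is 1 *)
Definition detq n (A : 'M[H]_n) : H :=
  if [pick x : 'I_n] is Some x then rdet x A else 1.

(* principal submatrix F^al_al, al in L_{k,n} represented as a set of
   indices, listed in increasing order *)
Definition princ n (F : 'M[H]_n) (al : {set 'I_n}) : 'M[H]_#|al| :=
  \matrix_(a, b) F (enum_val a) (enum_val b).

Definition posin n (al : {set 'I_n}) (j : 'I_n) : nat := index j (enum al).

Definition sum_rdet n (F : 'M[H]_n) (k : nat) (j : 'I_n) (b : 'rV[H]_n) : H :=
  \sum_(al : {set 'I_n} | (#|al| == k) && (j \in al))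
     rdet_at (posin al j) (princ (rowrep F j b) al).

Definition sum_cdet n (F : 'M[H]_n) (k : nat) (j : 'I_n) (c : 'cV[H]_n) : H :=
  \sum_(be : {set 'I_n} | (#|be| == k) && (j \in be))
     cdet_at (posin be j) (princ (colrep F j c) be).

Definition sum_minors n (F : 'M[H]_n) (k : nat) : H :=
  \sum_(al : {set 'I_n} | #|al| == k) detq (princ F al).

End QMatrix.

(* Main.v *)
(* Let F = A A^* and let e_k be the sum of its principal k-minors. The matrix
   S_k with entries sum_rdet F k j (row i F) equals F M_(k-1), where the M_k are
   the coefficients of an adjugate of t + F: as in the commutative case,
   F M_k + M_(k+1) = e_(k+1) I. This rests on two facts on row determinants of
   Hermitian matrices: inverting a cycle conjugates its product, so cycles other
   than the distinguished one contribute real numbers only; and splicing two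
   cycles with a transposition gives the cancellation for repeated rows.
   Consequently S_k and e_k obey the Faddeev-LeVerrier recursion, whence
   e_k(A A^* ) = e_k(A^* A). Positivity of Gram determinants shows that e_k
   is nonzero for k = rank A and vanishes beyond, and then S_k = e_k A A^dagger.
   Hence sum_rdet F k j (row i of C A^* ) = e_k (C A^dagger)_(i, j), and
   conjugation gives the statement for column determinants; the formulas of the
   theorem are combinations of these two. *)
Require Import Defs.
From HB Require Import structures.
From mathcomp Require Import all_boot all_order all_algebra all_fingroup.
From mathcomp Require Import reals.
From mathcomp Require Import ring lra zify.
Set Implicit Arguments. Unset Strict Implicit. Unset Printing Implicit Defensive.
Import Order.TTheory GRing.Theory Num.Theory.
Local Open Scope ring_scope.

(** * Quaternions *)

Section QuatBasics.
Variable R : realType.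
Local Notation H := (quat R).
Implicit Types x y z : H.

Definition qreal (a : R) : H := Quat a 0 0 0.

Fact q0_is_zmod_morphism : zmod_morphism (@q0 R). Proof. by []. Qed.
HB.instance Definition _ :=
  GRing.isZmodMorphism.Build H R (@q0 R) q0_is_zmod_morphism.

Fact qreal_is_zmod_morphism : zmod_morphism qreal.
Proof. by move=> a b; apply: quat_eq => /=; rewrite ?subr0. Qed.
HB.instance Definition _ :=
  GRing.isZmodMorphism.Build R H qreal qreal_is_zmod_morphism.

Fact qreal_is_monoid_morphism : monoid_morphism qreal.
Proof. by split=> // a b; apply: quat_eq => /=; ring. Qed.
HB.instance Definition _ :=
  GRing.isMonoidMorphism.Build R H qreal qreal_is_monoid_morphism.

Fact qconj_is_zmod_morphism : zmod_morphism (@qconj R).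
Proof. by move=> x y; apply: quat_eq => /=; ring. Qed.
HB.instance Definition _ :=
  GRing.isZmodMorphism.Build H H (@qconj R) qconj_is_zmod_morphism.

Lemma qrealC (a : R) x : x * qreal a = qreal a * x.
Proof. by apply: quat_eq => /=; ring. Qed.

Lemma qreal_inj : injective qreal. Proof. by move=> a b []. Qed.

Lemma qrealM_eq0 (a : R) x : a != 0 -> qreal a * x = 0 -> x = 0.
Proof.
move=> a0 ax; rewrite -[x]mul1r -[1]/(qreal 1) -(mulVf a0) rmorphM /=.
by rewrite -mulrA ax mulr0.
Qed.

Lemma qconjM x y : qconj (x * y) = qconj y * qconj x.
Proof. by apply: quat_eq => /=; ring. Qed.

Lemma qconjK : involutive (@qconj R).
Proof. by move=> x; apply: quat_eq => /=; rewrite ?opprK. Qed.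

Lemma qconj1 : qconj 1 = 1 :> H.
Proof. by apply: quat_eq => /=; rewrite ?oppr0. Qed.

Lemma qconj_qreal (a : R) : qconj (qreal a) = qreal a.
Proof. by apply: quat_eq => /=; rewrite ?oppr0. Qed.

Lemma q0_qconj x : q0 (qconj x) = q0 x. Proof. by []. Qed.

Lemma qaddconj x : x + qconj x = qreal (q0 x) + qreal (q0 x).
Proof. by apply: quat_eq => /=; ring. Qed.

Lemma q0_mulC x y : q0 (x * y) = q0 (y * x).
Proof. by rewrite /=; ring. Qed.

Lemma qconj_mul x : qconj x * x = qreal (qnorm2 x).
Proof. by apply: quat_eq; rewrite /= /qnorm2; ring. Qed.

Lemma qnorm2_ge0 x : 0 <= qnorm2 x.
Proof. by rewrite !addr_ge0 ?sqr_ge0. Qed.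

Lemma qnorm2_eq0 x : qnorm2 x = 0 -> x = 0.
Proof. by rewrite /qnorm2 => h; apply: quat_eq => /=; nra. Qed.

Lemma qinv_qreal (a : R) : qinv (qreal a) = qreal a^-1.
Proof.
have E : qnorm2 (qreal a) = a * a by rewrite /qnorm2 /=; ring.
apply: quat_eq; rewrite /= E ?oppr0 ?mul0r //.
have [->|a0] := eqVneq a 0; first by rewrite mul0r invr0.
by rewrite invfM mulrA divff // mul1r.
Qed.

Lemma quat_double_inj x y : x + x = y + y -> x = y.
Proof. by case: x => a b c d; case: y => e f g h [*]; apply: quat_eq => /=; lra. Qed.

Lemma qconj_prod (I : Type) (r : seq I) (P : pred I) (F : I -> H) :
  qconj (\prod_(i <- r | P i) F i) = \prod_(i <- rev r | P i) qconj (F i).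
Proof.
elim: r => [|a r IH]; first by rewrite !big_nil qconj1.
rewrite rev_cons -cats1 big_cat /= !big_cons big_nil -IH.
by case: (P a); rewrite ?qconjM ?mulr1.
Qed.

Lemma qconj_prod_ord k (F : 'I_k -> H) :
  qconj (\prod_(i < k) F i) = \prod_(i < k) qconj (F (rev_ord i)).
Proof.
elim: k F => [|k IH] F; first by rewrite !big_ord0 qconj1.
rewrite big_ord_recr /= qconjM IH big_ord_recl; congr (_ * _).
  by congr (qconj (F _)); apply: val_inj => /=; rewrite subn1.
by apply: eq_bigr => i _; congr (qconj (F _)); apply: val_inj.
Qed.

Lemma qsignE (b : bool) : (-1) ^+ b = qreal ((-1) ^+ b).
Proof. by rewrite rmorphXn /= rmorphN1. Qed.

Lemma qconj_sign (b : bool) : qconj ((-1) ^+ b) = (-1) ^+ b :> H.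
Proof. by rewrite qsignE qconj_qreal. Qed.

(** Reindexing by [f] shows that the doubled sums agree, and doubling is injective on quaternions;
    fixed points of [f] thus need no separate treatment. *)
Lemma sum_eq_invol (T : finType) (f : T -> T) (P : pred T) (F G : T -> H) :
  involutive f -> (forall t, P (f t) = P t) ->
  (forall t, P t -> F t + F (f t) = G t + G (f t)) ->
  \sum_(t | P t) F t = \sum_(t | P t) G t.
Proof.
move=> fK fP FG; apply: quat_double_inj.
have E (K : T -> H) :
    \sum_(t | P t) K t + \sum_(t | P t) K t = \sum_(t | P t) (K t + K (f t)).
  rewrite big_split; congr (_ + _); rewrite (reindex_inj (inv_inj fK)).
  exact: eq_bigl.
by rewrite !E; apply: eq_bigr.
Qed.

End QuatBasics.

(** * Cycles of permutations *)

Section PermCycles.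
Variable T : finType.
Implicit Types (s : {perm T}) (x y z : T).

Lemma mem_porbit_iter s x t : iter t s x \in porbit s x.
Proof. by rewrite -permX mem_porbit. Qed.

Lemma porbitPiter s x y :
  reflect (exists t, y = iter t s x) (y \in porbit s x).
Proof.
by apply: (iffP (porbitP s x y)) => -[t ->]; exists t; rewrite permX.
Qed.

Lemma mem_porbit_perm s x y : (s y \in porbit s x) = (y \in porbit s x).
Proof. by rewrite -!eq_porbit_mem -(porbit_perm s 1 y) expg1. Qed.

Lemma eq_iter_porbit s s' x t :
  {in porbit s x, s =1 s'} -> iter t s' x = iter t s x.
Proof.
by move=> ss'; elim: t => //= t ->; rewrite -ss' ?mem_porbit_iter.
Qed.

Lemma eq_porbit s s' x : {in porbit s x, s =1 s'} -> porbit s' x = porbit s x.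
Proof.
move=> ss'; apply/setP => y; apply/porbitPiter/porbitPiter => -[t ->].
  by exists t; rewrite (eq_iter_porbit _ ss').
by exists t; rewrite (eq_iter_porbit _ ss').
Qed.

Lemma porbit_fix s x : s x = x -> porbit s x = [set x].
Proof.
move=> sx; apply/setP => y; rewrite inE; apply/porbitPiter/eqP => [[t ->]|->].
  by elim: t => //= t ->.
by exists 0%N.
Qed.

Lemma mem_porbit_perm_on (A : {set T}) s x y :
  perm_on A s -> x \in A -> y \in porbit s x -> y \in A.
Proof.
move=> sA xA /porbitPiter[t ->]; elim: t => //= t IH.
by rewrite (perm_closed _ sA).
Qed.

(** The change in the number of cycles, written once for [s] and once for [tperm x y * s], adds up
    to this: exactly one of the two permutations has [x] and [y] in a common cycle. *)
Lemma mem_porbit_mul_tperm s x y : x != y ->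
  (x \in porbit (tperm x y * s)%g y) = (x \notin porbit s y).
Proof.
move=> xy; have := porbits_mul_tperm s x y; have := porbits_mul_tperm (tperm x y * s)%g x y.
rewrite /= mulgA tperm2 mul1g xy.
by case: (x \in _); case: (x \in _) => //=; lia.
Qed.

Definition flip_fun x s y := if y \in porbit s x then s^-1%g y else s y.

Lemma flip_funK x s : cancel (flip_fun x s) (flip_fun x s^-1).
Proof.
move=> y; rewrite /flip_fun porbitV invgK.
have [yx|yx] := ifPn (y \in _).
  by rewrite -(porbitV s) mem_porbit_perm porbitV yx permKV.
by rewrite mem_porbit_perm (negPf yx) permK.
Qed.

Definition flip x s : {perm T} := perm (can_inj (flip_funK x s)).

Lemma flip_in x s y : y \in porbit s x -> flip x s y = s^-1%g y.
Proof. by rewrite permE /flip_fun => ->. Qed.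

Lemma flip_out x s y : y \notin porbit s x -> flip x s y = s y.
Proof. by rewrite permE /flip_fun => /negPf->. Qed.

Lemma porbit_flip x s : porbit (flip x s) =1 porbit s.
Proof.
move=> z; have [zx|zx] := boolP (z \in porbit s x).
  rewrite -[RHS]porbitV; apply: eq_porbit => y; rewrite porbitV => yz.
  rewrite flip_in //; move: zx yz; rewrite -!eq_porbit_mem => /eqP <- //.
apply: eq_porbit => y yz; rewrite flip_out //.
by move: zx yz; rewrite -!eq_porbit_mem => zx /eqP->.
Qed.

Lemma flipK x : involutive (flip x).
Proof.
move=> s; apply/permP => y; have [yx|yx] := boolP (y \in porbit s x).
  rewrite flip_in ?porbit_flip //; apply: (canLR (permK _)).
  by rewrite flip_in ?permK // mem_porbit_perm.
by rewrite flip_out ?porbit_flip // flip_out.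
Qed.

Lemma odd_flip x s : odd_perm (flip x s) = odd_perm s.
Proof.
rewrite /odd_perm; congr (_ (+) odd _).
by rewrite /porbits (eq_imset _ (porbit_flip x s)).
Qed.

Lemma perm_on_flip (A : {set T}) x s : perm_on A (flip x s) = perm_on A s.
Proof.
suff imp s' : perm_on A s' -> perm_on A (flip x s').
  by apply/idP/idP => [/imp|/imp //]; rewrite flipK.
move=> sA; apply/subsetP => y; rewrite inE; apply: contraNT => yA.
rewrite permE /flip_fun (out_perm (perm_onV sA)) // (out_perm sA) //.
by case: ifP.
Qed.

(* [tperm i j * s] splices the cycles of [i] and [j]: started at [j] it first
   runs through the cycle of [i] under [s] and then through that of [j]. *)
Section Splice.
Variables (s : {perm T}) (i j : T).
Hypothesis ij : j \notin porbit s i.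
Let s' := (tperm i j * s)%g.

Let neq_ij : i != j.
Proof. by apply: contraNneq ij => ->; apply: porbit_id. Qed.

Lemma splice_j : s' j = s i. Proof. by rewrite permM tpermR. Qed.
Lemma splice_i : s' i = s j. Proof. by rewrite permM tpermL. Qed.
Lemma splice_out y : y != i -> y != j -> s' y = s y.
Proof. by move=> yi yj; rewrite permM tpermD // eq_sym. Qed.

Lemma iter_splice1 t : (0 < t <= #|porbit s i|)%N -> iter t s' j = iter t s i.
Proof.
elim: t => [//|[|t] IH] /andP[_ tp]; first exact: splice_j.
rewrite [LHS]iterS IH ?[RHS]iterS; last by rewrite (ltnW tp).
apply: splice_out; last first.
  by apply: contraNneq ij => <-; apply: mem_porbit_iter.
(* A return to [i] before the end of the turn would repeat an entry of a duplicate-free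
   trajectory. *)
have U := uniq_traject_porbit s i; apply: contraTneq U => E.
case: #|porbit s i| tp => // p tp; rewrite /= negb_and negbK; apply/orP; left.
rewrite -{1}E; apply/trajectP; exists t; first by rewrite ltnS in tp; lia.
by rewrite -iterSr.
Qed.

Lemma iter_splice_mid : iter #|porbit s i| s' j = i.
Proof.
by rewrite iter_splice1 ?iter_porbit // leqnn andbT lt0n card_porbit_neq0.
Qed.

Lemma iter_splice2 t : (0 < t <= #|porbit s j|)%N ->
  iter (t + #|porbit s i|) s' j = iter t s j.
Proof.
rewrite iterD iter_splice_mid.
elim: t => [//|[|t] IH] /andP[_ tp]; first exact: splice_i.
rewrite [LHS]iterS IH ?[RHS]iterS; last by rewrite (ltnW tp).
apply: splice_out.
  by apply: contraNneq ij => <-; rewrite porbit_sym; apply: mem_porbit_iter.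
have U := uniq_traject_porbit s j; apply: contraTneq U => E.
case: #|porbit s j| tp => // p tp; rewrite /= negb_and negbK; apply/orP; left.
rewrite -{1}E; apply/trajectP; exists t; first by rewrite ltnS in tp; lia.
by rewrite -iterSr.
Qed.

Lemma porbit_splice : porbit s' j = porbit s i :|: porbit s j.
Proof.
apply/setP => y; rewrite inE; apply/porbitPiter/orP => [[t ->]|].
  elim: t => [|t IH] /=; first by right; rewrite porbit_id.
  set z := iter t s' j in IH *.
  have [->|zi] := eqVneq z i.
    by right; rewrite splice_i mem_porbit_perm porbit_id.
  have [->|zj] := eqVneq z j.
    by left; rewrite splice_j mem_porbit_perm porbit_id.
  by rewrite splice_out // !mem_porbit_perm.
(* The two iteration lemmas cover exponents from 1 to the cycle length, so exponent 0 is traded for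
   a full turn. *)
have sub z : y \in porbit s z ->
    exists2 t, y = iter t s z & (0 < t <= #|porbit s z|)%N.
  rewrite porbit_traject => /trajectP[[|t] tp ->].
    exists #|porbit s z|; first by rewrite iter_porbit.
    by rewrite leqnn andbT lt0n card_porbit_neq0.
  by exists t.+1 => //=; apply: ltnW.
case=> /sub[t -> tp]; first by exists t; rewrite iter_splice1.
by exists (t + #|porbit s i|)%N; rewrite iter_splice2.
Qed.

Lemma card_porbit_splice : #|porbit s' j| = (#|porbit s i| + #|porbit s j|)%N.
Proof.
rewrite porbit_splice cardsU; have -> : porbit s i :&: porbit s j = set0.
  apply/setP => y; rewrite !inE -!eq_porbit_mem; apply/andP => -[/eqP yi /eqP yj].
  by case/negP: ij; rewrite -eq_porbit_mem -yj yi.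
by rewrite cards0 subn0.
Qed.

Lemma porbit_splice_out y : y \notin porbit s i -> y \notin porbit s j ->
  porbit s' y = porbit s y.
Proof.
move=> yi yj; apply: eq_porbit => z zy; rewrite splice_out //.
  by apply: contraNneq yi => <-; rewrite porbit_sym.
by apply: contraNneq yj => <-; rewrite porbit_sym.
Qed.

End Splice.
End PermCycles.

(** * Products along cycles *)

Section CycleProducts.
Variables (R : realType) (n : nat).
Local Notation H := (quat R).
Implicit Types (A : 'M[H]_n) (s : 'S_n) (i j x y : 'I_n) (u : 'rV[H]_n).

Lemma cycprodE A s x : cycprod A s x =
  \prod_(t < #|porbit s x|) A (iter t s x) (iter t.+1 s x).
Proof. by apply: eq_bigr => t _; rewrite !permX. Qed.

Lemma eq_cycprod A A' s s' x :
  {in porbit s x, forall z, s z = s' z} ->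
  {in porbit s x, forall z, A z (s z) = A' z (s z)} ->
  cycprod A' s' x = cycprod A s x.
Proof.
move=> ss' AA'; rewrite !cycprodE (eq_porbit ss'); apply: eq_bigr => t _.
by rewrite !(eq_iter_porbit _ ss') /= -AA' ?mem_porbit_iter.
Qed.

(** Row [x] is read only by the first factor of the cycle product started at [x]; these remaining
    factors survive a replacement of that row. *)
Definition cyctail A s x :=
  \prod_(t < #|porbit s x|.-1) A (iter t.+1 s x) (iter t.+2 s x).

Lemma cycprod_recl A s x : cycprod A s x = A x (s x) * cyctail A s x.
Proof.
rewrite cycprodE /cyctail; case: #|_| (card_porbit_neq0 s x) => // k _.
by rewrite big_ord_recl.
Qed.

Lemma iter_neq_start s x t : (t.+1 < #|porbit s x|)%N -> iter t.+1 s x != x.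
Proof.
have := uniq_traject_porbit s x; case: #|porbit s x| => // k U tk.
apply: contraTneq U => E; rewrite /= negb_and negbK; apply/orP; left.
rewrite -{1}E; apply/trajectP; exists t; first by [].
by rewrite -iterSr.
Qed.

Lemma cyctail_rowrep A s x u : cyctail (rowrep A x u) s x = cyctail A s x.
Proof.
apply: eq_bigr => t _; rewrite mxE (negPf (iter_neq_start _)) //.
by have := ltn_ord t; lia.
Qed.

Lemma cycprod_rowrep A s x u :
  cycprod (rowrep A x u) s x = u 0 (s x) * cyctail A s x.
Proof. by rewrite cycprod_recl cyctail_rowrep mxE eqxx. Qed.

Lemma cycprod_rowrep_out A s x y u : y \notin porbit s x ->
  cycprod (rowrep A y u) s x = cycprod A s x.
Proof.
move=> yx; apply: eq_cycprod => // z zx; rewrite mxE.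
by case: eqP zx => // ->; rewrite (negPf yx).
Qed.

Lemma rowrep_row A x : rowrep A x (row x A) = A.
Proof. by apply/matrixP => a b; rewrite !mxE; case: eqP => // ->. Qed.

Lemma cycprod_fix A s x : s x = x -> cycprod A s x = A x x.
Proof.
by move=> sx; rewrite cycprod_recl /cyctail porbit_fix // cards1 big_ord0 mulr1 sx.
Qed.

(** Moving the start rotates the product cyclically, and the real part behaves like a trace. *)
Lemma q0_cycprod_step A s x : q0 (cycprod A s (s x)) = q0 (cycprod A s x).
Proof.
rewrite cycprod_recl [in RHS]cycprod_recl.
have E : porbit s (s x) = porbit s x by apply/eqP; rewrite eq_porbit_mem mem_porbit_perm porbit_id.
rewrite [in RHS]q0_mulC.
have -> : A (s x) (s (s x)) * cyctail A s (s x) = cycprod A s (s x).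
  by rewrite cycprod_recl.
congr q0; rewrite cycprodE /cyctail E.
have := iter_porbit s x; have := card_porbit_neq0 s x.
case: #|porbit s x| => // k _ sk; rewrite big_ord_recr /=; congr (_ * _).
  by apply: eq_bigr => t _; rewrite -!iterSr.
by rewrite -!iterSr /= -iterS sk.
Qed.

Lemma q0_cycprod A s x y : y \in porbit s x ->
  q0 (cycprod A s y) = q0 (cycprod A s x).
Proof.
by case/porbitPiter=> t ->; elim: t => //= t IH; rewrite q0_cycprod_step.
Qed.

(** Conjugation reverses the order of the factors, so the cycle is traversed backwards. *)
Lemma qconj_cycprod A s x : qconj (cycprod A s x) = cycprod (adjq A) s^-1 x.
Proof.
rewrite !cycprodE qconj_prod_ord porbitV; apply: eq_bigr => t _.
rewrite mxE; set k := #|_| in t *.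
have iterV a b : (a + b = k)%N -> iter b s^-1%g x = iter a s x.
  move=> ab; rewrite -{1}(iter_porbit s x) -/k -ab addnC iterD.
  by elim: b {ab} => //= b IH; rewrite -iterS iterSr /= permK IH.
by congr (qconj (A _ _)); apply/esym/iterV; have /= := ltn_ord t; lia.
Qed.

Lemma cycprod_flip_out A s x y : y \notin porbit s x ->
  cycprod A (flip x s) y = cycprod A s y.
Proof.
move=> yx; apply: eq_cycprod => // z zy; rewrite flip_out //.
by apply: contraNN yx; move: zy; rewrite -!eq_porbit_mem => /eqP->.
Qed.

Lemma cycprod_flip A s x : adjq A = A ->
  cycprod A (flip x s) x = qconj (cycprod A s x).
Proof.
move=> hA; rewrite qconj_cycprod hA; apply: eq_cycprod => // z.
by rewrite porbitV => zx; rewrite flip_in.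
Qed.

(** The spliced cycle leaves [j] by the entry of [u] at [s i], follows the cycle of [i], and passes
    from [i] to [s j] by an entry of row [i]. That entry opens the cycle of [j] once row [j] has
    become row [i]. *)
Lemma cycprod_splice A s i j u : j \notin porbit s i ->
  cycprod (rowrep A j u) (tperm i j * s)%g j =
  cycprod (rowrep A i u) s i * cycprod (rowrep A j (row i A)) s j.
Proof.
move=> ij; rewrite [LHS]cycprod_recl !cycprod_rowrep cyctail_rowrep mxE eqxx.
rewrite splice_j !mxE -mulrA; congr (_ * _).
have := card_porbit_splice ij; rewrite addnC => cd.
have [p pE] : exists p, #|porbit s i| = p.+1.
  by case: #|_| (card_porbit_neq0 s i) => // p _; exists p.
have [q qE] : exists q, #|porbit s j| = q.+1.
  by case: #|_| (card_porbit_neq0 s j) => // q _; exists q.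
rewrite /cyctail cd pE qE.
have -> : (q.+1 + p.+1).-1 = (p + q.+1)%N by lia.
rewrite [LHS]big_split_ord /= big_ord_recl /=; congr (_ * _).
  apply: eq_bigr => t _; have tp := ltn_ord t.
  by rewrite -![s _]/(iter _.+1 _ _) -!iterS !(iter_splice1 ij) ?pE //= ltnS ltnW.
have mid : iter p.+1 (tperm i j * s)%g j = i by rewrite -pE (iter_splice_mid ij).
rewrite addn0 -!iterS; congr (_ * _).
  by rewrite [iter p.+2 _ _]iterS mid splice_i.
apply: eq_bigr => t _; have tq := ltn_ord t; rewrite /bump /= -!iterS.
have -> : (p + (1 + t)).+1 = (t.+1 + #|porbit s i|)%N by rewrite pE; lia.
by rewrite -addSn !(iter_splice2 ij) ?qE //= ltnS ltnW.
Qed.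

End CycleProducts.

(** * Least elements as representatives of cycles *)

Section Leaders.
Variable n : nat.
Implicit Types (s : 'S_n) (x y : 'I_n) (al : {set 'I_n}).

Lemma cycleader_eq s s' x : porbit s' x = porbit s x ->
  cycleader s' x = cycleader s x.
Proof. by rewrite /cycleader => ->. Qed.

Lemma cycleader_inj s x y :
  cycleader s x -> cycleader s y -> y \in porbit s x -> x = y.
Proof.
move=> /forall_inP lx /forall_inP ly yx; apply/val_inj/eqP.
by rewrite eqn_leq lx //= ly // porbit_sym.
Qed.

Lemma cycleader_exists s x : exists2 y, y \in porbit s x & cycleader s y.
Proof.
case: (@arg_minnP _ x (fun z => z \in porbit s x) val (porbit_id s x)) => y yx ymin.
exists y => //; apply/forall_inP => z; rewrite -eq_porbit_mem => /eqP zy.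
by apply: ymin; rewrite -eq_porbit_mem zy eq_porbit_mem.
Qed.

(** The cycle of [x] has exactly one leader, and since [r] is constant on that cycle the leader's
    factor may be read at [x]. *)
Lemma prod_cycleaders (R : comRingType) s al (r : 'I_n -> R) (B : pred 'I_n) x :
  perm_on al s -> x \in al ->
  {in porbit s x, forall y, B y} -> {in porbit s x, forall y, r y = r x} ->
  \prod_(y in al | cycleader s y && B y) r y =
  r x * \prod_(y in al | cycleader s y && ((y \notin porbit s x) && B y)) r y.
Proof.
move=> sal xal Bx rx; have [z zx lz] := cycleader_exists s x.
rewrite (bigD1 z) /=; last first.
  by rewrite (mem_porbit_perm_on sal xal zx) lz Bx.
rewrite rx //; congr (_ * _); apply: eq_bigl => y.
case: (y \in al) => //=; have [ly|//] := boolP (cycleader s y) => /=.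
rewrite andbC; have [yx|yx] := boolP (y \in porbit s x) => /=.
  have /(cycleader_inj lz ly)-> : y \in porbit s z; last by rewrite eqxx.
  by move: zx yx; rewrite -!eq_porbit_mem => /eqP-> /eqP->.
by case: eqP yx => // ->; rewrite zx.
Qed.

End Leaders.

Lemma sum_card_setU1 (V : nmodType) (T : finType) (k : nat) (i : T)
    (P : pred {set T}) (G : {set T} -> V) :
  \sum_(al : {set T} | [&& #|al| == k.+1, i \in al & P al]) G al =
  \sum_(al : {set T} | [&& #|al| == k, i \notin al & P (i |: al)]) G (i |: al).
Proof.
rewrite (reindex_onto (fun al => i |: al) (fun al => al :\ i)) /=; last first.
  by move=> al /and3P[_ ial _]; rewrite setD1K.
apply: eq_bigl => al; have [ial|ial] := boolP (i \in al) => /=.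
  rewrite andbF; apply/andP => -[_ /eqP E].
  by move: ial; rewrite -E !inE eqxx.
by rewrite setU1K // eqxx andbT cardsU1 ial setU11 add1n eqSS.
Qed.

(** * Row determinants of Hermitian matrices *)

Section HermitianDet.
Variables (R : realType) (n : nat).
Local Notation H := (quat R).
Implicit Types (A : 'M[H]_n) (s : 'S_n) (i j x y : 'I_n) (u : 'rV[H]_n)
  (al : {set 'I_n}).

(* The row determinant at [j] of the principal submatrix on [al], as a sum
   over the permutations of the whole index set that are supported in [al]. *)
Definition pdet al j A : H :=
  \sum_(s | perm_on al s) (-1) ^+ odd_perm s *
    (cycprod A s j *
     \prod_(x in al | cycleader s x && (x \notin porbit s j)) cycprod A s x).

Definition cycrest A s al j : R :=
  \prod_(x in al | cycleader s x && (x \notin porbit s j)) q0 (cycprod A s x).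

(** For Hermitian [A] this is the common value of the row determinants on [al], see
    [pdet_hermitian]. With real parts everywhere, neither a distinguished index nor an order of the
    cycles is involved. *)
Definition mdet A al : R :=
  \sum_(s | perm_on al s) (-1) ^+ odd_perm s *
     \prod_(x in al | cycleader s x) q0 (cycprod A s x).

Variable F : 'M[H]_n.
Hypothesis hF : adjq F = F.

(* Inverting the cycle through [x] conjugates its product, so that on average
   only the real part of this product matters. *)
Lemma sum_cycprod_real x (P : pred 'S_n) (f g : 'S_n -> H) :
  (forall s, P (flip x s) = P s) ->
  (forall s, P s -> f (flip x s) = f s) ->
  (forall s, P s -> g (flip x s) = g s) ->
  \sum_(s | P s) f s * cycprod F s x * g s =
  \sum_(s | P s) f s * qreal (q0 (cycprod F s x)) * g s.
Proof.
move=> Px fx gx; apply: (sum_eq_invol (@flipK _ x)) => // s Ps.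
rewrite fx // gx // cycprod_flip // q0_qconj -!mulrDl -!mulrDr qaddconj.
by rewrite mulrDr !mulrDl.
Qed.

(** Induction on the list: the head factor is absorbed into [g] while the tail is made real, and is
    then averaged by reversing its own cycle. Selected indices represent different cycles, so this
    reversal leaves the other factors alone. *)
Lemma sum_prod_cycprod_real (l : seq 'I_n) (P : pred 'S_n)
    (Q : 'S_n -> pred 'I_n) (g : 'S_n -> H) :
  uniq l ->
  (forall x s, P (flip x s) = P s) -> (forall x s, Q (flip x s) =1 Q s) ->
  (forall s x y, Q s x -> Q s y -> y \in porbit s x -> x = y) ->
  (forall s x, P s -> Q s x -> x \in l -> g (flip x s) = g s) ->
  \sum_(s | P s) g s * \prod_(x <- l | Q s x) cycprod F s x =
  \sum_(s | P s) g s * qreal (\prod_(x <- l | Q s x) q0 (cycprod F s x)).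
Proof.
move=> + flP flQ Qinj; elim: l g => [|y l IH] g /=.
  by move=> _ _; apply: eq_bigr => s _; rewrite !big_nil rmorph1.
move=> /andP[yl ul] gfl; pose c s := if Q s y then cycprod F s y else 1.
transitivity (\sum_(s | P s) g s * c s * \prod_(x <- l | Q s x) cycprod F s x).
  apply: eq_bigr => s _; rewrite big_cons /c.
  by case: (Q s y); rewrite ?mulrA ?mulr1.
rewrite IH //; last first.
  move=> s x Ps Qx xl; rewrite gfl ?inE ?xl ?orbT // /c flQ.
  case: ifP => // Qy; rewrite cycprod_flip_out //.
  by apply: contraNN yl => /(Qinj _ _ _ Qx Qy) <-.
pose rc s := if Q s y then q0 (cycprod F s y) else 1.
transitivity (\sum_(s | P s) g s * qreal (rc s) *
    qreal (\prod_(x <- l | Q s x) q0 (cycprod F s x))); last first.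
  apply: eq_bigr => s _; rewrite big_cons /rc.
  by case: (Q s y); rewrite ?rmorph1 ?mulr1 // -mulrA -rmorphM.
rewrite (bigID (fun s => Q s y)) [RHS](bigID (fun s => Q s y)) /=.
congr (_ + _); last first.
  by apply: eq_bigr => s /andP[_ /negPf Qy]; rewrite /c /rc Qy rmorph1.
under eq_bigr => s Ps do rewrite /c (andP Ps).2.
under [RHS]eq_bigr => s Ps do rewrite /rc (andP Ps).2.
apply: sum_cycprod_real => s; first by rewrite flP flQ.
  by case/andP => Ps Qy; rewrite gfl ?inE ?eqxx.
case/andP => Ps Qy; congr qreal.
rewrite big_seq_cond [RHS]big_seq_cond; apply: eq_big => x; first by rewrite flQ.
case/andP => xl; rewrite flQ => Qx; rewrite cycprod_flip_out //.
by apply: contraNN yl => /(Qinj _ _ _ Qy Qx) ->.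
Qed.

End HermitianDet.

(** * Cofactors and the adjugate relation for Hermitian matrices *)

Section Cofactors.
Variables (R : realType) (n : nat).
Local Notation H := (quat R).
Implicit Types (s : 'S_n) (i j x y : 'I_n) (u : 'rV[H]_n) (al : {set 'I_n}).
Variable F : 'M[H]_n.
Hypothesis hF : adjq F = F.

(** The new row [j] is read only in the cycle of [j]; all other cycles see the Hermitian [F], so
    their products may be replaced by real parts. *)
Lemma pdet_rowrep al j u : pdet al j (rowrep F j u) =
  \sum_(s | perm_on al s) (-1) ^+ odd_perm s *
    cycprod (rowrep F j u) s j * qreal (cycrest F s al j).
Proof.
pose Q s x := [&& x \in al, cycleader s x & x \notin porbit s j].
transitivity (\sum_(s | perm_on al s) (-1) ^+ odd_perm s *
    cycprod (rowrep F j u) s j *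
    \prod_(x <- index_enum 'I_n | Q s x) cycprod F s x).
  apply: eq_bigr => s _; rewrite mulrA; congr (_ * _).
  apply: eq_bigr => x /and3P[_ _ xj]; apply: cycprod_rowrep_out.
  by rewrite porbit_sym.
apply: sum_prod_cycprod_real => //.
- exact: index_enum_uniq.
- by move=> x s; rewrite perm_on_flip.
- by move=> x s y; rewrite /Q porbit_flip (cycleader_eq (porbit_flip _ _ _)).
- by move=> s x y /and3P[_ lx _] /and3P[_ ly _]; apply: cycleader_inj.
move=> s x _ /and3P[_ _ xj] _; rewrite odd_flip cycprod_flip_out //.
by rewrite porbit_sym.
Qed.

Lemma cycrest2_flip al i j s : i \notin porbit s j ->
  \prod_(x in al | cycleader (flip i s) x && ((x \notin porbit (flip i s) i) &&
     (x \notin porbit (flip i s) j))) q0 (cycprod F (flip i s) x) =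
  \prod_(x in al | cycleader s x && ((x \notin porbit s i) &&
     (x \notin porbit s j))) q0 (cycprod F s x).
Proof.
move=> ij; apply: eq_big => x.
  by rewrite !porbit_flip (cycleader_eq (porbit_flip _ _ _)).
by rewrite porbit_flip => /and4P[_ _ xi _]; rewrite cycprod_flip_out.
Qed.

Lemma cycrest_splice al i j s : j \notin porbit s i ->
  cycrest F (tperm i j * s)%g al j =
  \prod_(x in al | cycleader s x && ((x \notin porbit s i) &&
     (x \notin porbit s j))) q0 (cycprod F s x).
Proof.
move=> ij; have P x : x \notin porbit (tperm i j * s)%g j =
    (x \notin porbit s i) && (x \notin porbit s j).
  by rewrite porbit_splice // inE negb_or.
apply: eq_big => x.
  rewrite P; case: (x \in al) => //=; rewrite andbC [RHS]andbC.
  case: (boolP ((x \notin porbit s i) && (x \notin porbit s j))) => // /andP[xi xj] /=.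
  by apply: cycleader_eq; apply: porbit_splice_out.
rewrite P => /and4P[_ _ xi xj]; congr q0; apply: eq_cycprod => // z zx.
rewrite splice_out //.
  by apply: contraNneq xi => <-; rewrite porbit_sym.
by apply: contraNneq xj => <-; rewrite porbit_sym.
Qed.

Lemma perm_on_splice al i j s : i \in al -> j \in al ->
  perm_on al (tperm i j * s)%g = perm_on al s.
Proof.
move=> ial jal; have T : perm_on al (tperm i j).
  by apply: subset_trans (tperm_on i j) _; apply/subsetP => x /set2P[]->.
apply/idP/idP => [h|h]; last exact: perm_onM.
by rewrite -[s]mul1g -(tperm2 i j) -mulgA; apply: perm_onM.
Qed.

Lemma sign_splice i j s : i != j ->
  (-1) ^+ odd_perm (tperm i j * s)%g = - (-1) ^+ odd_perm s :> H.
Proof.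
move=> ij; rewrite odd_mul_tperm ij /=.
by case: odd_perm; rewrite /= ?expr0 ?expr1 ?opprK.
Qed.

(** Multiplication by [tperm i j] changes the sign and exchanges the permutations having [i] and [j]
    in one cycle with those having them in two. After splicing, one half contains the cycle product
    at [i] and the other its real part; reversing the cycle of [i] removes this difference. *)
Lemma pdet_repeated_row al i j : i != j -> i \in al -> j \in al ->
  pdet al j (rowrep F j (row i F)) = 0.
Proof.
move=> ij ial jal; rewrite pdet_rowrep (bigID (fun s => i \in porbit s j)) /=.
rewrite (reindex_inj (mulgI (tperm i j))) /=.
pose rest s := \prod_(x in al | cycleader s x && ((x \notin porbit s i) &&
     (x \notin porbit s j))) q0 (cycprod F s x).
pose c s := cycprod (rowrep F j (row i F)) s j.
transitivity (- (\sum_(s | perm_on al s && (i \notin porbit s j))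
     (-1) ^+ odd_perm s * cycprod F s i * (c s * qreal (rest s))) +
   \sum_(s | perm_on al s && (i \notin porbit s j))
     (-1) ^+ odd_perm s * qreal (q0 (cycprod F s i)) * (c s * qreal (rest s))).
  congr (_ + _).
    rewrite -sumrN; apply: eq_big => s.
      by rewrite perm_on_splice // mem_porbit_mul_tperm.
    rewrite perm_on_splice // mem_porbit_mul_tperm // porbit_sym.
    case/andP => _ ijs; rewrite sign_splice // cycprod_splice // rowrep_row.
    by rewrite cycrest_splice // /c /rest !mulNr !mulrA.
  (* Here the cycle of [i] is one of those avoiding [j], and its real part is split off from their
     product. *)
  apply: eq_bigr => s /andP[sal ijs]; rewrite /cycrest.
  rewrite (@prod_cycleaders _ _ s al (fun x => q0 (cycprod F s x)) _ i) //.
  - rewrite rmorphM /= -/(rest s) /c -!mulrA; congr (_ * _); rewrite !mulrA.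
    by congr (_ * _); apply: qrealC.
  - move=> y; rewrite porbit_sym => yi; apply: contraNN ijs.
    by move: yi; rewrite -!eq_porbit_mem => /eqP ->.
  - by move=> y yi; apply: q0_cycprod.
rewrite (sum_cycprod_real hF (x := i)) ?addNr //.
- by move=> s; rewrite perm_on_flip porbit_flip.
- by move=> s _; rewrite odd_flip.
move=> s /andP[_ ijs]; rewrite /c /rest cycrest2_flip // cycprod_flip_out //.
by rewrite porbit_sym.
Qed.

Lemma pdet_rowrep_delta_out al i j : i \notin al -> j \in al ->
  pdet al j (rowrep F j (delta_mx 0 i)) = 0.
Proof.
move=> ial jal; rewrite pdet_rowrep big1 // => s sal.
rewrite cycprod_rowrep mxE eqxx /=.
case: eqP => [E|_]; last by rewrite mul0r mulr0 mul0r.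
by case/negP: ial; rewrite -E (perm_closed _ sal).
Qed.

Lemma perm_onU1 al i s : i \notin al ->
  perm_on (i |: al) s && (s i == i) = perm_on al s.
Proof.
move=> ial; apply/andP/idP => [[sal /eqP si]|sal].
  apply/subsetP => x; rewrite inE => sx; have /setU1P[xi|//] : x \in i |: al.
    by apply: (subsetP sal); rewrite inE.
  by case/negP: sx; rewrite xi si.
split; last by rewrite (out_perm sal).
by apply: subset_trans sal _; apply: subsetUr.
Qed.

(** Only permutations sending [j] to [i] contribute. They are [tperm i j * s] with [s] fixing [i],
    that is, supported in [al]; the transposition gives the minus sign. *)
Lemma pdet_add_row al i j : i \notin al -> j \in al ->
  pdet (i |: al) j (rowrep F j (delta_mx 0 i)) =
  - pdet al j (rowrep F j (row i F)).
Proof.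
move=> ial jal; have ij : i != j by apply: contraNneq ial => ->.
rewrite !pdet_rowrep (reindex_inj (mulgI (tperm i j))) /=.
rewrite (bigID (fun s : 'S_n => s i == i)) /= [X in _ + X]big1 ?addr0 => [|s]; last first.
  case/andP => _ /negPf si; rewrite cycprod_rowrep splice_j mxE si andbF.
  by rewrite mul0r mulr0 mul0r.
rewrite -sumrN; apply: eq_big => s.
  by rewrite perm_on_splice ?setU11 ?setU1r // perm_onU1.
rewrite perm_on_splice ?setU11 ?setU1r // perm_onU1 // => sal.
have si := out_perm sal ial; have oi := porbit_fix si.
have ijs : j \notin porbit s i by rewrite oi inE eq_sym.
rewrite sign_splice // cycprod_splice // cycrest_splice //.
rewrite [cycprod _ s i]cycprod_fix // !mxE !eqxx mul1r !mulNr; congr (- (_ * qreal _)).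
apply: eq_bigl => x; rewrite oi !inE.
by case: eqP => [->|] //=; rewrite (negPf ial) andbF.
Qed.

Lemma cycrest_flip_start al j s :
  cycrest F (flip j s) al j = cycrest F s al j.
Proof.
apply: eq_big => x.
  by rewrite !porbit_flip (cycleader_eq (porbit_flip _ _ _)).
by rewrite porbit_flip => /and3P[_ _ xi]; rewrite cycprod_flip_out.
Qed.

Lemma qreal_mdet al : qreal (mdet F al) =
  \sum_(s | perm_on al s) (-1) ^+ odd_perm s *
     qreal (\prod_(x in al | cycleader s x) q0 (cycprod F s x)).
Proof.
by rewrite rmorph_sum; apply: eq_bigr => s _; rewrite rmorphM rmorphXn /= rmorphN1.
Qed.

(** Reversing the cycle of [j] makes the distinguished product real too, after which it is one
    factor among the others. *)
Lemma pdet_hermitian al j : j \in al -> pdet al j F = qreal (mdet F al).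
Proof.
move=> jal; rewrite -{1}(rowrep_row F j) pdet_rowrep rowrep_row qreal_mdet.
rewrite (sum_cycprod_real hF (x := j)).
- apply: eq_bigr => s sal; rewrite -mulrA -rmorphM; congr (_ * qreal _).
  have := @prod_cycleaders _ _ s al (fun x => q0 (cycprod F s x)) xpredT j sal jal.
  under eq_bigl => x do rewrite andbT.
  move=> -> //; last by move=> y yj; apply: q0_cycprod.
  by congr (_ * _); apply: eq_bigl => x; rewrite andbT.
- by move=> s; rewrite perm_on_flip.
- by move=> s _; rewrite odd_flip.
by move=> s _; rewrite cycrest_flip_start.
Qed.

Lemma pdet_rowrep_delta_diag al j : j \notin al ->
  pdet (j |: al) j (rowrep F j (delta_mx 0 j)) = qreal (mdet F al).
Proof.
move=> jal; rewrite pdet_rowrep qreal_mdet.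
rewrite (bigID (fun s : 'S_n => s j == j)) /= [X in _ + X]big1 ?addr0 => [|s]; last first.
  case/andP => _ /negPf sj; rewrite cycprod_rowrep mxE sj andbF.
  by rewrite mul0r mulr0 mul0r.
apply: eq_big => s; rewrite perm_onU1 // => sal.
have sj := out_perm sal jal; rewrite cycprod_fix // !mxE !eqxx mulr1.
congr (_ * qreal _); apply: eq_bigl => x; rewrite (porbit_fix sj) !inE.
by case: eqP => [->|] /=; rewrite ?(negPf jal) ?andbF ?andbT.
Qed.

Definition minors_sum k : R := \sum_(al : {set 'I_n} | #|al| == k) mdet F al.

Definition pdet_sum k j u : H :=
  \sum_(al : {set 'I_n} | (#|al| == k) && (j \in al)) pdet al j (rowrep F j u).

Lemma pdet_sum_row k j :
  pdet_sum k j (row j F) =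
  \sum_(al : {set 'I_n} | (#|al| == k) && (j \in al)) qreal (mdet F al).
Proof.
by apply: eq_bigr => al /andP[_ jal]; rewrite rowrep_row pdet_hermitian.
Qed.

Lemma pdet_sum_delta k j :
  pdet_sum k.+1 j (delta_mx 0 j) =
  \sum_(al : {set 'I_n} | (#|al| == k) && (j \notin al)) qreal (mdet F al).
Proof.
rewrite /pdet_sum; under eq_bigl => al do rewrite -[j \in al]andbT.
rewrite (sum_card_setU1 _ _ xpredT); under eq_bigl => al do rewrite andbT.
by apply: eq_bigr => al /andP[_ jal]; rewrite pdet_rowrep_delta_diag.
Qed.

(* The entrywise form of [(t + F) adj(t + F) = det(t + F) I], coefficient by
   coefficient in [t]. *)
Lemma pdet_sum_recurrence k i j :
  pdet_sum k.+1 j (delta_mx 0 i) + pdet_sum k j (row i F) =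
  qreal (minors_sum k) *+ (i == j).
Proof.
have [->|ij] /= := eqVneq i j.
  rewrite pdet_sum_row pdet_sum_delta addrC mulr1n rmorph_sum /=.
  by rewrite [RHS](bigID (fun al : {set 'I_n} => j \in al)).
(* Off the diagonal, only sets containing [i] count in the first sum and only sets avoiding [i] in
   the second; adding [i] to a set matches them with opposite signs. *)
rewrite /pdet_sum (bigID (fun al : {set 'I_n} => i \in al)) /=.
rewrite [X in _ + X + _]big1 ?addr0 => [|al]; last first.
  by case/andP => /andP[_ jal] ial; apply: pdet_rowrep_delta_out.
under eq_bigl => al do rewrite -andbA [(j \in al) && _]andbC.
rewrite sum_card_setU1 [X in _ + X](bigID (fun al : {set 'I_n} => i \in al)) /=.
rewrite [X in _ + (X + _)]big1 ?add0r => [|al]; last first.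
  by case/andP => /andP[_ jal] ial; apply: pdet_repeated_row.
under [X in _ + X]eq_bigl => al do rewrite -andbA [(j \in al) && _]andbC.
have inj al : (j \in i |: al) = (j \in al) by rewrite !inE eq_sym (negPf ij).
under eq_bigl => al do rewrite inj.
rewrite -big_split big1 // => al /and3P[_ ial jal].
by rewrite /= pdet_add_row // addNr.
Qed.

(** Apart from the central sign, the entry of [u] is the leftmost factor, so coefficients come out
    on the left. *)
Lemma pdet_sum_linear k j u :
  pdet_sum k j u = \sum_l u 0 l * pdet_sum k j (delta_mx 0 l).
Proof.
under [RHS]eq_bigr => l _ do rewrite mulr_sumr.
rewrite exchange_big; apply: eq_bigr => al _ /=.
under [RHS]eq_bigr => l _ do rewrite pdet_rowrep mulr_sumr.
rewrite pdet_rowrep exchange_big; apply: eq_bigr => s _ /=.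
rewrite (bigD1 (s j)) //= [X in _ + X]big1 ?addr0 => [|l ls].
  by rewrite !cycprod_rowrep mxE !eqxx mul1r !mulrA qsignE -(qrealC _ (u 0 (s j))).
by rewrite cycprod_rowrep mxE eq_sym (negPf ls) andbF mul0r !mulr0 mul0r mulr0.
Qed.

End Cofactors.

(** * Principal submatrices *)

Section ExtendPerm.
Variables (n : nat) (al : {set 'I_n}).
Implicit Types (s t : 'S_#|al|) (a b : 'I_#|al|) (x : 'I_n).
Local Notation ev := (@enum_val _ (mem al)).

Lemma mem_enum_valP x : x \in al -> exists a, x = ev a.
Proof. by move=> xal; exists (enum_rank_in xal x); rewrite enum_rankK_in. Qed.

(** [enum] lists a set in increasing order; this is what carries cycle leaders of the submatrix to
    cycle leaders of the whole index set. *)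
Lemma leq_enum_val a b : (ev a <= ev b)%N = (a <= b)%N.
Proof.
have srt : sorted ltn ([seq val x | x <- enum al]).
  rewrite sorted_map /enum_mem -enumT.
  apply: sorted_filter => [? ? ?|]; first exact: ltn_trans.
  by have := iota_ltn_sorted 0 n; rewrite -val_enum_ord sorted_map.
have nthE c : val (ev c) = nth 0%N ([seq val x | x <- enum al]) c.
  by rewrite (enum_val_nth (ev c)) (nth_map (ev c)) // -cardE.
have lt (c d : 'I_#|al|) : (c < d)%N -> (ev c < ev d)%N.
  move=> cd; rewrite !nthE; apply: (sorted_ltn_nth ltn_trans) => //.
    by rewrite inE size_map -cardE.
  by rewrite inE size_map -cardE.
have [/lt/ltnW->|/lt|/val_inj->] := ltngtP a b => //; last by rewrite leqnn.
by rewrite ltnNge => /negPf.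
Qed.

Definition extend_fun s x :=
  if [pick a | ev a == x] is Some a then ev (s a) else x.

Lemma extend_fun_in s a : extend_fun s (ev a) = ev (s a).
Proof.
rewrite /extend_fun; case: pickP => [b /eqP/enum_val_inj->//|/(_ a)].
by rewrite eqxx.
Qed.

Lemma extend_fun_out s x : x \notin al -> extend_fun s x = x.
Proof.
move=> xal; rewrite /extend_fun; case: pickP => // a /eqP ax.
by case/negP: xal; rewrite -ax enum_valP.
Qed.

Lemma extend_funK s : cancel (extend_fun s) (extend_fun s^-1).
Proof.
move=> x; have [/mem_enum_valP[a ->]|xal] := boolP (x \in al).
  by rewrite !extend_fun_in permK.
by rewrite !extend_fun_out.
Qed.

Definition extend_perm s : 'S_n := perm (can_inj (extend_funK s)).

Lemma extend_perm_in s a : extend_perm s (ev a) = ev (s a).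
Proof. by rewrite permE extend_fun_in. Qed.

Lemma extend_perm_out s x : x \notin al -> extend_perm s x = x.
Proof. by move=> xal; rewrite permE extend_fun_out. Qed.

Lemma perm_on_extend s : perm_on al (extend_perm s).
Proof.
apply/subsetP => x; rewrite inE; apply: contraNT => /extend_perm_out->.
exact: eqxx.
Qed.

Lemma extend_perm_inj : injective extend_perm.
Proof.
move=> s t st; apply/permP => a; apply: enum_val_inj.
by rewrite -!extend_perm_in st.
Qed.

Lemma extend_permM s t : extend_perm (s * t)%g = (extend_perm s * extend_perm t)%g.
Proof.
apply/permP => x; rewrite permM.
have [/mem_enum_valP[a ->]|xal] := boolP (x \in al).
  by rewrite !extend_perm_in permM.
by rewrite !extend_perm_out.
Qed.

Lemma extend_tperm a b : extend_perm (tperm a b) = tperm (ev a) (ev b).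
Proof.
apply/permP => x; have [/mem_enum_valP[c ->]|xal] := boolP (x \in al).
  by rewrite extend_perm_in; apply: (inj_tperm _ _ _ enum_val_inj).
rewrite extend_perm_out // tpermD //.
  by apply: contraNneq xal => <-; apply: enum_valP.
by apply: contraNneq xal => <-; apply: enum_valP.
Qed.

Lemma odd_extend s : odd_perm (extend_perm s) = odd_perm s.
Proof.
have [ts -> _] := prod_tpermP s; elim: ts => [|[a b] ts IH].
  rewrite !big_nil odd_perm1; suff -> : extend_perm 1 = 1%g by rewrite odd_perm1.
  apply/permP => x; rewrite perm1; have [/mem_enum_valP[c ->]|xal] := boolP (x \in al).
    by rewrite extend_perm_in perm1.
  by rewrite extend_perm_out.
rewrite !big_cons extend_permM !odd_permM IH extend_tperm !odd_tperm.
by rewrite (inj_eq enum_val_inj).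
Qed.

(** [extend_perm] is injective into the permutations supported in [al], and both sets have [#|al|]
    factorial elements. *)
Lemma sum_perm_on (V : nmodType) (G : 'S_n -> V) :
  \sum_(s | perm_on al s) G s = \sum_(s : 'S_#|al|) G (extend_perm s).
Proof.
transitivity (\sum_(s in [set: 'S_#|al|]) G (extend_perm s)); last first.
  by apply: eq_bigl => s; rewrite inE.
rewrite -(@big_imset _ _ _ _ _ extend_perm _ G) /=; last first.
  by move=> s t _ _; apply: extend_perm_inj.
have /subset_cardP E : #|extend_perm @: [set: 'S_#|al|]| = #|perm_on al|.
  by rewrite (card_imset _ extend_perm_inj) cardsT card_Sn card_perm.
apply/esym/eq_bigl/E/subsetP => s /imsetP[t _ ->]; exact: perm_on_extend.
Qed.

Lemma iter_extend s a k : iter k (extend_perm s) (ev a) = ev (iter k s a).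
Proof. by elim: k => //= k ->; rewrite extend_perm_in. Qed.

Lemma porbit_extend s a : porbit (extend_perm s) (ev a) = ev @: porbit s a.
Proof.
apply/setP => x; apply/porbitPiter/imsetP => [[k ->]|[b /porbitPiter[k ->] ->]].
  by exists (iter k s a); rewrite ?iter_extend ?mem_porbit_iter.
by exists k; rewrite iter_extend.
Qed.

Lemma mem_porbit_extend s a b :
  (ev b \in porbit (extend_perm s) (ev a)) = (b \in porbit s a).
Proof. by rewrite porbit_extend mem_imset //; apply: enum_val_inj. Qed.

Lemma cycleader_extend s a : cycleader (extend_perm s) (ev a) = cycleader s a.
Proof.
apply/forall_inP/forall_inP => h b; last first.
  by rewrite porbit_extend => /imsetP[c ca ->]; rewrite leq_enum_val h.
by rewrite -mem_porbit_extend => /h; rewrite leq_enum_val.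
Qed.

Variable R : realType.
Local Notation H := (quat R).

Lemma cycprod_extend (A : 'M[H]_n) s a :
  cycprod A (extend_perm s) (ev a) = cycprod (princ A al) s a.
Proof.
rewrite !cycprodE porbit_extend card_imset; last exact: enum_val_inj.
by apply: eq_bigr => t _; rewrite !iter_extend mxE.
Qed.

Lemma prod_enum_val (S : pzSemiRingType) (P : pred 'I_n) (G : 'I_n -> S) :
  \prod_(x in al | P x) G x = \prod_(a < #|al| | P (ev a)) G (ev a).
Proof.
rewrite -big_filter_cond [index_enum _]unlock -/(enum al).
have [x0 x0al|al0] := pickP (mem al); last first.
  have c0 : #|al| = 0%N by apply: eq_card0.
  rewrite (size0nil (etrans (esym (cardE _)) c0)) big_nil big1 // => a _.
  by case/negP: (negbT (al0 (ev a))); apply: enum_valP.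
rewrite (big_nth x0) -cardE big_mkord; apply: eq_big => a.
  by rewrite (enum_val_nth x0).
by rewrite (enum_val_nth x0).
Qed.

Lemma sign_porbits m (s : 'S_m) :
  (-1) ^+ (m - #|porbits s|) = (-1) ^+ odd_perm s :> H.
Proof.
have le : (#|porbits s| <= m)%N by rewrite -[X in (_ <= X)%N]card_ord leq_imset_card.
by rewrite -signr_odd oddB // /odd_perm card_ord.
Qed.

Lemma rdet_princ (A : 'M[H]_n) a : rdet a (princ A al) = pdet al (ev a) A.
Proof.
rewrite /pdet sum_perm_on; apply: eq_bigr => s _.
rewrite sign_porbits odd_extend cycprod_extend prod_enum_val.
congr (_ * (_ * _)); apply: eq_big => b.
  by rewrite cycleader_extend mem_porbit_extend.
by rewrite cycprod_extend.
Qed.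

Lemma mdet_princ (A : 'M[H]_n) : mdet A al = mdet (princ A al) [set: 'I_#|al|].
Proof.
rewrite /mdet sum_perm_on; apply: eq_big => [s|s _].
  by apply/esym/subsetP => x _; rewrite inE.
rewrite odd_extend prod_enum_val; congr (_ * _).
apply: eq_big => b; first by rewrite cycleader_extend inE.
by rewrite cycprod_extend.
Qed.

Lemma rdet_at_princ (A : 'M[H]_n) j : j \in al ->
  rdet_at (posin al j) (princ A al) = pdet al j A.
Proof.
move=> jal; rewrite /rdet_at; case: pickP => [a /eqP aE|].
  have aj : ev a = j by rewrite (enum_val_nth j) aE /posin nth_index ?mem_enum.
  by rewrite rdet_princ aj.
have lt : (posin al j < #|al|)%N by rewrite cardE index_mem mem_enum.
by move/(_ (Ordinal lt)); rewrite eqxx.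
Qed.

End ExtendPerm.

(** * Conjugate transposes, Gram matrices and real traces *)

Section Adjoint.
Variable R : realType.
Local Notation H := (quat R).

Lemma adjqK m n (A : 'M[H]_(m, n)) : adjq (adjq A) = A.
Proof. by apply/matrixP => i j; rewrite !mxE qconjK. Qed.

Lemma adjqM m n p (A : 'M[H]_(m, n)) (B : 'M[H]_(n, p)) :
  adjq (A *m B) = adjq B *m adjq A.
Proof.
apply/matrixP => i j; rewrite !mxE raddf_sum; apply: eq_bigr => k _.
by rewrite /= !mxE qconjM.
Qed.

Lemma adjq_gram m n (A : 'M[H]_(m, n)) : adjq (adjq A *m A) = adjq A *m A.
Proof. by rewrite adjqM adjqK. Qed.

Lemma adjq_gramr m n (A : 'M[H]_(m, n)) : adjq (A *m adjq A) = A *m adjq A.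
Proof. by rewrite adjqM adjqK. Qed.

Lemma is_MPinv_adjq m n (A : 'M[H]_(m, n)) (X : 'M[H]_(n, m)) :
  is_MPinv A X -> is_MPinv (adjq A) (adjq X).
Proof.
by case=> e1 e2 e3 e4; split; rewrite -!adjqM ?mulmxA ?e1 ?e2 ?e3 ?e4.
Qed.

Lemma mulmx_qscale m n p (a : R) (A : 'M[H]_(m, n)) (B : 'M[H]_(n, p)) :
  A *m (qreal a *: B) = qreal a *: (A *m B).
Proof.
apply/matrixP => i j; rewrite !mxE mulr_sumr; apply: eq_bigr => k _.
by rewrite !mxE !mulrA qrealC.
Qed.

Lemma gram_diag m n (Z : 'M[H]_(m, n)) j :
  (adjq Z *m Z) j j = qreal (\sum_i qnorm2 (Z i j)).
Proof.
rewrite !mxE rmorph_sum; apply: eq_bigr => i _.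
by rewrite /= mxE qconj_mul.
Qed.

Lemma gram_eq0 m n (Z : 'M[H]_(m, n)) : adjq Z *m Z = 0 -> Z = 0.
Proof.
move=> Z0; apply/matrixP => i j; rewrite mxE; apply: qnorm2_eq0.
have := gram_diag Z j; rewrite Z0 mxE -(rmorph0 (@qreal R)).
move=> /qreal_inj/esym/eqP; rewrite psumr_eq0 => [/allP|*]; last exact: qnorm2_ge0.
by move=> /(_ i (mem_index_enum _))/eqP.
Qed.

Lemma gram_mul_eq0 m n p (A : 'M[H]_(m, n)) (Y : 'M[H]_(n, p)) :
  adjq A *m (A *m Y) = 0 -> A *m Y = 0.
Proof. by move=> E; apply: gram_eq0; rewrite adjqM -mulmxA E mulmx0. Qed.

(** Over the quaternions the full trace is not invariant under exchange of two factors; its real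
    part is. *)
Definition retrace n (A : 'M[H]_n) : R := \sum_i q0 (A i i).

Lemma retrace_mulC m n (A : 'M[H]_(m, n)) (B : 'M[H]_(n, m)) :
  retrace (A *m B) = retrace (B *m A).
Proof.
rewrite /retrace; under eq_bigr => i _ do rewrite mxE raddf_sum.
rewrite exchange_big; apply: eq_bigr => i _.
by rewrite mxE raddf_sum; apply: eq_bigr => j _; apply: q0_mulC.
Qed.

End Adjoint.

(** * The Faddeev-LeVerrier recursion *)

Section Recurrence.
Variables (R : realType) (n : nat).
Local Notation H := (quat R).

Lemma mdet0 (F : 'M[H]_n) : mdet F set0 = 1.
Proof.
rewrite /mdet (big_pred1 1%g) => [|s]; last first.
  apply/idP/eqP => [s0|->]; last exact: perm_on1.
  by apply: (perm_on_id s0); rewrite cards0.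
by rewrite odd_perm1 mul1r big_pred0 // => x; rewrite inE.
Qed.

Lemma minors_sum0 (F : 'M[H]_n) : minors_sum F 0%N = 1.
Proof.
rewrite /minors_sum (big_pred1 set0) ?mdet0 // => al.
by rewrite cards_eq0.
Qed.

Lemma minors_sum_full (F : 'M[H]_n) : minors_sum F n = mdet F [set: 'I_n].
Proof.
rewrite /minors_sum (big_pred1 [set: 'I_n]) // => al /=.
have := max_card (mem al); rewrite eqEcard subsetT cardsT card_ord /= eqn_leq.
by move=> ->.
Qed.

Lemma sum_rdetE (F : 'M[H]_n) k j b : sum_rdet F k j b = pdet_sum F k j b.
Proof. by apply: eq_bigr => al /andP[_ jal]; rewrite rdet_at_princ. Qed.

(** The coefficient M_k of the adjugate of t + F. A unit vector in place of a row lowers the degree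
    in the entries by one, hence the size [k.+1]. *)
Definition cofmx (F : 'M[H]_n) k : 'M[H]_n :=
  \matrix_(i, j) pdet_sum F k.+1 j (delta_mx 0 i).

Definition rowmx (F : 'M[H]_n) k : 'M[H]_n :=
  \matrix_(i, j) pdet_sum F k j (row i F).

Variable F : 'M[H]_n.
Hypothesis hF : adjq F = F.

Lemma sum_minorsE k : sum_minors F k = qreal (minors_sum F k).
Proof.
rewrite rmorph_sum; apply: eq_bigr => al _ /=; rewrite /detq.
case: pickP => [x _|al0].
  by rewrite rdet_princ pdet_hermitian //; apply: enum_valP.
have -> : al = set0.
  apply/setP => x; rewrite inE; apply/negP => /mem_enum_valP[a _].
  by have := al0 a.
by rewrite mdet0.
Qed.

Lemma cofmxE k : cofmx F k = (qreal (minors_sum F k))%:M - rowmx F k.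
Proof.
apply/matrixP => i j; rewrite !mxE -(pdet_sum_recurrence hF).
by rewrite addrK.
Qed.

Lemma pdet_sum_row_mul m (Y : 'M[H]_(m, n)) k i j :
  pdet_sum F k j (row i (Y *m F)) = (Y *m rowmx F k) i j.
Proof.
rewrite pdet_sum_linear // !mxE.
under eq_bigr => l _ do rewrite !mxE mulr_suml.
rewrite exchange_big; apply: eq_bigr => l _ /=.
rewrite !mxE pdet_sum_linear // mulr_sumr; apply: eq_bigr => t _.
by rewrite !mxE mulrA.
Qed.

Lemma mul_cofmx k : F *m cofmx F k = rowmx F k.+1.
Proof.
apply/matrixP => i j; rewrite [in RHS]mxE pdet_sum_linear // mxE.
by apply: eq_bigr => l _; rewrite !mxE.
Qed.

Lemma rowmx0 : rowmx F 0%N = 0.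
Proof.
apply/matrixP => i j; rewrite !mxE /pdet_sum big_pred0 // => al.
by apply/andP => -[]; rewrite cards_eq0 => /eqP ->; rewrite inE.
Qed.

Lemma rowmxS k :
  rowmx F k.+1 = qreal (minors_sum F k) *: F - F *m rowmx F k.
Proof.
by rewrite -mul_cofmx cofmxE mulmxBr -[_%:M]mulmx1 mul_scalar_mx mulmx_qscale mulmx1.
Qed.

Lemma rowmx_comm k : F *m rowmx F k = rowmx F k *m F.
Proof.
elim: k => [|k IH]; first by rewrite rowmx0 mulmx0 mul0mx.
by rewrite rowmxS mulmxBr mulmxBl mulmx_qscale -scalemxAl -mulmxA -IH.
Qed.

Lemma cofmx_comm k : F *m cofmx F k = cofmx F k *m F.
Proof.
rewrite cofmxE mulmxBr mulmxBl rowmx_comm mul_scalar_mx; congr (_ - _).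
by rewrite -[_%:M]mulmx1 mul_scalar_mx mulmx_qscale mulmx1.
Qed.

(** No principal submatrix is larger than [F]. By [cofmxE] this turns [rowmx F n] into the scalar
    matrix of [minors_sum F n], as in F adj F = det F. *)
Lemma cofmx_oversize k : (n <= k)%N -> cofmx F k = 0.
Proof.
move=> nk; apply/matrixP => i j; rewrite !mxE /pdet_sum big_pred0 // => al.
apply/andP => -[/eqP alk _]; have := max_card (mem al).
by rewrite card_ord alk leqNgt ltnS nk.
Qed.

(** Each minor of size [k] is counted once for every index it contains. *)
Lemma retrace_rowmx k : retrace (rowmx F k) = minors_sum F k *+ k.
Proof.
rewrite /retrace; transitivity (\sum_(j < n)
    \sum_(al : {set 'I_n} | (#|al| == k) && (j \in al)) mdet F al).
  by apply: eq_bigr => j _; rewrite mxE pdet_sum_row // raddf_sum.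
rewrite (exchange_big_dep (fun al : {set 'I_n} => #|al| == k)) /=; last first.
  by move=> j al _ /andP[].
rewrite /minors_sum -sumrMnl; apply: eq_bigr => al /eqP alk.
under eq_bigl => j do rewrite alk eqxx.
by rewrite sumr_const alk.
Qed.

End Recurrence.

(** * Gram determinants and rank *)

Section Gram.
Variable R : realType.
Local Notation H := (quat R).

Definition injmx m n (K : 'M[H]_(m, n)) :=
  forall v : 'cV[H]_n, K *m v = 0 -> v = 0.

(* [S_k] and [e_k] satisfy the Faddeev-LeVerrier recursion, in which only
   real traces of powers occur; these agree for [A A^*] and [A^* A]. *)
Lemma minors_sum_gram m n (A : 'M[H]_(m, n)) k :
  minors_sum (A *m adjq A) k = minors_sum (adjq A *m A) k /\
  rowmx (A *m adjq A) k *m A = A *m rowmx (adjq A *m A) k.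
Proof.
elim: k => [|k [eqe eqS]]; first by rewrite !minors_sum0 !rowmx0 mul0mx mulmx0.
have h1 := adjq_gramr A; have h2 := adjq_gram A.
have eqS1 : rowmx (A *m adjq A) k.+1 *m A = A *m rowmx (adjq A *m A) k.+1.
  rewrite !rowmxS // mulmxBl mulmxBr mulmx_qscale -scalemxAl eqe.
  by rewrite -!mulmxA eqS.
(* The real trace of [rowmx] yields the minor sum [k.+1] times, a factor that cancels in [R]. *)
split=> //; apply: (@pmulrnI _ k.+1) => //; rewrite -!retrace_rowmx //.
rewrite -mul_cofmx // -[in RHS]mul_cofmx // -!mulmxA retrace_mulC.
congr retrace; rewrite -!mulmxA; congr (_ *m _).
rewrite !cofmxE // mulmxBl mulmxBr eqS eqe mul_scalar_mx; congr (_ - _).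
by rewrite -[_%:M]mulmx1 mul_scalar_mx mulmx_qscale mulmx1.
Qed.

Lemma injmx_colsub m n k (K : 'M[H]_(m, n)) (f : 'I_k -> 'I_n) :
  injective f -> injmx K -> injmx (colsub f K).
Proof.
(* The witness [w] spreads [v] along [f] and is zero off the image. *)
move=> finj Kinj v Kv; pose w : 'cV[H]_n := \col_i \sum_(a | f a == i) v a 0.
have w0 : w = 0.
  apply: Kinj; rewrite -Kv; apply/matrixP => x y; rewrite !mxE.
  under eq_bigr => i _ do rewrite mxE mulr_sumr.
  rewrite (exchange_big_dep xpredT) //=; apply: eq_bigr => a _.
  by rewrite (big_pred1 (f a)) ?mxE ?(ord1 y) // => i; rewrite eq_sym.
apply/matrixP => a y; rewrite (ord1 y) mxE.
have /matrixP/(_ (f a) 0) := w0; rewrite !mxE (big_pred1 a) // => b.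
exact: inj_eq.
Qed.

Lemma princ_gram m n (K : 'M[H]_(m, n)) (al : {set 'I_n}) :
  princ (adjq K *m K) al =
  adjq (colsub (@enum_val _ (mem al)) K) *m colsub (@enum_val _ (mem al)) K.
Proof.
by apply/matrixP => a b; rewrite !mxE; apply: eq_bigr => i _; rewrite !mxE.
Qed.

Lemma mdet_gram m n (K : 'M[H]_(m, n)) (al : {set 'I_n}) :
  mdet (adjq K *m K) al =
  mdet (adjq (colsub (@enum_val _ (mem al)) K) *m colsub (@enum_val _ (mem al)) K)
    [set: 'I_#|al|].
Proof. by rewrite mdet_princ princ_gram. Qed.

(* If [v] is the [j]-th column of the adjugate of [K^* K], then
   [|K v|^2 = v_j det (K^* K)], and [v_j] is a smaller Gram determinant. *)
Lemma gram_det_gt0 m n (K : 'M[H]_(m, n)) :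
  injmx K -> 0 < mdet (adjq K *m K) [set: 'I_n].
Proof.
have [N nN] : exists N, n = N by exists n.
elim: N n nN m K => [|N IH] n nN m K Kinj; rewrite -minors_sum_full.
  have -> : minors_sum (adjq K *m K) n = minors_sum (adjq K *m K) 0%N.
    by congr (minors_sum _ _).
  by rewrite minors_sum0; apply: ltr01.
have hF := adjq_gram K; set F := adjq K *m K in hF *.
have jn : (0 < n)%N by rewrite nN.
pose j : 'I_n := Ordinal jn; pose v := col j (cofmx F N).
pose a := \sum_(al : {set 'I_n} | (#|al| == N) && (j \notin al)) mdet F al.
(* The summands are smaller Gram determinants, positive by induction, and the complement of [j]
   shows that the sum is not empty. *)
have a_gt0 : 0 < a.
  have pos (al : {set 'I_n}) : #|al| = N -> 0 < mdet F al.
    move=> alN; rewrite mdet_gram; apply: IH => //.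
    by apply: injmx_colsub => //; apply: enum_val_inj.
  rewrite /a (bigD1 [set~ j]) /=; last first.
    by rewrite !inE eqxx andbT cardsC1 card_ord nN.
  rewrite ltr_wpDr //; last by rewrite pos // cardsC1 card_ord nN.
  by apply: sumr_ge0 => al /andP[/andP[/eqP/pos/ltW]].
have vj : v j 0 = qreal a.
  by rewrite !mxE pdet_sum_delta // rmorph_sum.
have Fv : F *m v = qreal (minors_sum F n) *: delta_mx j 0.
  have: F *m cofmx F N = (qreal (minors_sum F n))%:M.
    rewrite mul_cofmx // -nN; apply/esym/eqP; rewrite -subr_eq0 -cofmxE //.
    by rewrite cofmx_oversize.
  by rewrite /v colE mulmxA => ->; rewrite mul_scalar_mx.
have E : \sum_i qnorm2 ((K *m v) i 0) = a * minors_sum F n.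
  apply: qreal_inj; rewrite -gram_diag adjqM -mulmxA [_ *m (K *m v)]mulmxA -/F Fv.
  rewrite mulmx_qscale mxE mulrC rmorphM /=; congr (_ * _).
  rewrite mxE (bigD1 j) //= big1 => [|i /negPf ij]; last first.
    by rewrite [delta_mx _ _ _ _]mxE ij mulr0.
  by rewrite addr0 [delta_mx _ _ _ _]mxE !eqxx mulr1 mxE vj qconj_qreal.
rewrite -(pmulr_rgt0 _ a_gt0) -E lt_neqAle; apply/andP; split; last first.
  by apply: sumr_ge0 => i _; apply: qnorm2_ge0.
(* If the squared length were zero, injectivity of [K] would give [v = 0], against
   [v j 0 = a > 0]. *)
rewrite eq_sym psumr_eq0 => [|i _]; last exact: qnorm2_ge0.
apply: contraTN a_gt0 => /allP z.
suff v0 : v = 0.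
  by have /esym/(congr1 (@q0 R)) := vj; rewrite v0 mxE /= => ->; rewrite ltxx.
apply: Kinj; apply/matrixP => i y; rewrite (ord1 y) [RHS]mxE.
exact/qnorm2_eq0/eqP/(z i (mem_index_enum _)).
Qed.

(** The adjugate is a left inverse of the Gram matrix up to its determinant, so [K *m v = 0] makes a
    nonzero real multiple of [v] vanish. *)
Lemma gram_det_neq0 m n (K : 'M[H]_(m, n)) :
  mdet (adjq K *m K) [set: 'I_n] != 0 -> injmx K.
Proof.
rewrite -minors_sum_full => nz v Kv.
have hF := adjq_gram K; set F := adjq K *m K in hF nz *.
case: n => [|N] in K v Kv F hF nz *; first by apply/matrixP => -[].
have: F *m cofmx F N = (qreal (minors_sum F N.+1))%:M.
  rewrite mul_cofmx //; apply/esym/eqP; rewrite -subr_eq0 -cofmxE //.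
  by rewrite cofmx_oversize.
rewrite cofmx_comm // => /(congr1 (mulmx^~ v)); rewrite -!mulmxA Kv !mulmx0.
rewrite mul_scalar_mx => /matrixP E; apply/matrixP => i j.
by have := E i j; rewrite !mxE => /esym/(qrealM_eq0 nz).
Qed.

(** Every principal minor here is the Gram determinant of a choice of columns: nonnegative, and
    nonzero exactly when these are independent. So [r] independent columns give a positive term, and
    larger sets give zero. *)
Lemma has_rankq_minors m n (A : 'M[H]_(m, n)) r : has_rankq A r ->
  0 < minors_sum (adjq A *m A) r /\
  (forall l, (r < l)%N -> minors_sum (adjq A *m A) l = 0).
Proof.
case=> [[f [finj Af]] rmax]; set F := adjq A *m A; split; last first.
  move=> l rl; apply: big1 => al /eqP all; apply: contraTeq rl => nz.
  rewrite -leqNgt -all; apply: (rmax _ (@enum_val _ (mem al))).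
  split; first exact: enum_val_inj.
  by apply: gram_det_neq0; rewrite -mdet_gram.
have ge0 al : 0 <= mdet F al.
  have [->//|nz] := eqVneq (mdet F al) 0.
  rewrite mdet_gram ltW //; apply: gram_det_gt0; apply: gram_det_neq0.
  by rewrite -mdet_gram.
pose be := f @: [set: 'I_r].
have cbe : #|be| = r by rewrite card_imset // cardsT card_ord.
rewrite /minors_sum (bigD1 be) ?cbe //= ltr_wpDr //; first exact: sumr_ge0.
rewrite mdet_gram; apply: gram_det_gt0.
(* [f] need not be increasing, whereas [be] is listed in order; [g] translates positions in [be]
   into arguments of [f]. *)
have gP (a : 'I_#|be|) : exists b, f b == enum_val a.
  by have /imsetP[b _ ->] := enum_valP a; exists b.
pose g a := xchoose (gP a); have fg a : f (g a) = enum_val a.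
  exact/eqP/(xchooseP (gP a)).
have ginj : injective g.
  by move=> a b gab; apply: enum_val_inj; rewrite -!fg gab.
have -> : colsub (@enum_val _ (mem be)) A = colsub g (colsub f A).
  by apply/matrixP => x y; rewrite !mxE fg.
exact: injmx_colsub.
Qed.

End Gram.

(** * Cramer's rule for the Moore-Penrose inverse *)

Section Cramer.
Variable R : realType.
Local Notation H := (quat R).

Lemma qrealMM (a b : R) (x y : H) :
  qreal a * x * (qreal b * y) = qreal (a * b) * (x * y).
Proof. by rewrite rmorphM -!mulrA; congr (_ * _); rewrite !mulrA qrealC. Qed.

(* For [l > r] the recursion reads [M_(l+1) = - F M_l]; as [M_l] vanishes for
   large [l], a power of [F] kills [M_r], hence so does [F] itself. *)
Lemma mul_cofmx_rank n (F : 'M[H]_n) r : adjq F = F ->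
  (forall l, (r < l)%N -> minors_sum F l = 0) -> F *m cofmx F r = 0.
Proof.
move=> hF e0; suff gen d l : (r <= l)%N -> (n <= l + d)%N -> F *m cofmx F l = 0.
  by apply: (gen n); rewrite ?leq_addl.
elim: d l => [|d IH] l rl nl.
  by rewrite cofmx_oversize ?mulmx0 // -(addn0 l).
have := IH l.+1 (leqW rl); rewrite addSnnS => /(_ nl).
rewrite [cofmx F l.+1]cofmxE // e0 // rmorph0 sub0r -mul_cofmx // mulmxN.
by move/eqP; rewrite oppr_eq0 -{1}hF => /eqP/gram_mul_eq0.
Qed.

(** Vanishing of [F *m cofmx F r] means that [rowmx F r] acts on [F] as the scalar [e]. The
    projector [P] has [F] as a left factor and is a right identity for [rowmx F r], so the scalar
    passes to [P]. *)
Lemma rowmx_projector m n (A : 'M[H]_(m, n)) (Ad : 'M[H]_(n, m)) r :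
  is_MPinv A Ad ->
  (forall l, (r < l)%N -> minors_sum (A *m adjq A) l = 0) ->
  rowmx (A *m adjq A) r = qreal (minors_sum (A *m adjq A) r) *: (A *m Ad).
Proof.
move=> [AXA XAX hAX hXA] e0; have hF := adjq_gramr A.
set F := A *m adjq A in e0 hF *; set e := minors_sum F r; set P := A *m Ad.
have FS : rowmx F r *m F = qreal e *: F.
  rewrite -rowmx_comm //; have := mul_cofmx_rank hF e0.
  rewrite cofmxE // mulmxBr => /eqP; rewrite subr_eq0 => /eqP <-.
  by rewrite -[_%:M]mulmx1 mul_scalar_mx mulmx_qscale mulmx1.
have PE : P = F *m (adjq Ad *m Ad).
  by rewrite /F !mulmxA -[A *m adjq A *m _]mulmxA -adjqM hXA !mulmxA AXA.
have FP : F *m P = F.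
  by rewrite /F -mulmxA -[P]hAX -adjqM AXA.
have SP : rowmx F r *m P = rowmx F r.
  case: (r) => [|k]; first by rewrite rowmx0 mul0mx.
  by rewrite -mul_cofmx // cofmx_comm // -mulmxA FP.
by rewrite -SP PE mulmxA FS -scalemxAl -PE.
Qed.

(** [C *m adjq A] equals [C *m Ad *m (A *m adjq A)], so left linearity reduces the sum to the
    projector formula, and [Ad *m A *m Ad = Ad] finishes. *)
Lemma sum_rdet_MPinv m n p (A : 'M[H]_(m, n)) (Ad : 'M[H]_(n, m)) r
    (C : 'M[H]_(p, n)) i j :
  is_MPinv A Ad ->
  (forall l, (r < l)%N -> minors_sum (A *m adjq A) l = 0) ->
  sum_rdet (A *m adjq A) r j (row i (C *m adjq A)) =
  qreal (minors_sum (A *m adjq A) r) * (C *m Ad) i j.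
Proof.
move=> MP e0; have hF := adjq_gramr A; have [AXA XAX hAX hXA] := MP.
have -> : C *m adjq A = C *m Ad *m (A *m adjq A).
  by rewrite -[in LHS]AXA -mulmxA adjqM hXA !mulmxA.
rewrite sum_rdetE pdet_sum_row_mul // (rowmx_projector MP e0) mulmx_qscale mxE.
by rewrite -mulmxA [Ad *m _]mulmxA XAX.
Qed.

(** Conjugation reverses the order of the cycles, which matches [rev] in [cdet], and inverts each
    cycle, which reindexing over inverses undoes. *)
Lemma cdet_adjq n (A : 'M[H]_n) j : cdet j (adjq A) = qconj (rdet j A).
Proof.
rewrite raddf_sum /= (reindex_inj invg_inj); apply: eq_bigr => s _ /=.
rewrite qconjM !sign_porbits odd_permV qconj_sign qconjM qsignE -qrealC.
congr (_ * _); rewrite qconj_cycprod invgK; congr (_ * _).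
rewrite qconj_prod [index_enum _]unlock -enumT; apply: eq_big => x.
  by rewrite porbitV (cycleader_eq (porbitV _ _)).
by rewrite qconj_cycprod invgK.
Qed.

Lemma sum_cdet_adjq n (F : 'M[H]_n) k j (b : 'rV[H]_n) :
  sum_cdet (adjq F) k j (adjq b) = qconj (sum_rdet F k j b).
Proof.
rewrite raddf_sum; apply: eq_bigr => al _ /=.
have -> : princ (colrep (adjq F) j (adjq b)) al = adjq (princ (rowrep F j b) al).
  by apply/matrixP => x y; rewrite !mxE; case: eqP.
rewrite /cdet_at /rdet_at; case: pickP => [x _|_]; first exact: cdet_adjq.
by rewrite raddf0.
Qed.

(** This is the row formula for [adjq A] and [adjq C], conjugated. *)
Lemma sum_cdet_MPinv m n p (A : 'M[H]_(m, n)) (Ad : 'M[H]_(n, m)) r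
    (C : 'M[H]_(m, p)) i j :
  is_MPinv A Ad ->
  (forall l, (r < l)%N -> minors_sum (adjq A *m A) l = 0) ->
  sum_cdet (adjq A *m A) r i (col j (adjq A *m C)) =
  qreal (minors_sum (adjq A *m A) r) * (Ad *m C) i j.
Proof.
move=> MP e0; rewrite -{1}(adjq_gram A).
have -> : col j (adjq A *m C) = adjq (row j (adjq C *m adjq (adjq A))).
  by apply/matrixP => x y; rewrite -adjqM !mxE qconjK.
rewrite sum_cdet_adjq -{1 2}[A in _ *m A]adjqK.
rewrite (sum_rdet_MPinv _ _ _ (is_MPinv_adjq MP)) ?adjqK //.
by rewrite -adjqM qconjM qconj_qreal mxE qconjK qrealC.
Qed.

End Cramer.

(** * Entrywise formulas for [X1] and [X2] *)

Theorem theorem4p4 (R : realType) (r s m p q r1 r2 r3 r4 : nat)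
  (B1 : 'M[quat R]_(r, s)) (A2 : 'M[quat R]_(m, p))
  (B2 : 'M[quat R]_(q, s)) (C : 'M[quat R]_(m, s))
  (B1d : 'M[quat R]_(s, r)) (A2d : 'M[quat R]_(p, m)) (Nd : 'M[quat R]_(s, q)) :
  has_rankq B1 r1 -> has_rankq A2 r2 -> has_rankq B2 r3 ->
  is_MPinv B1 B1d -> is_MPinv A2 A2d ->
  let N := B2 *m (1%:M - B1d *m B1) in        (* N = B2 L_{B1} *)
  has_rankq N r4 -> is_MPinv N Nd ->
  let X1 := C *m B1d - (A2 *m A2d) *m C *m Nd *m B2 *m B1d in
  let X2 := A2d *m C *m Nd in
  let BB := B1 *m adjq B1 in                  (* B1 B1^*  *)
  let AA := A2 *m adjq A2 in                  (* A2 A2^*  *)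
  let AsA := adjq A2 *m A2 in                 (* A2^* A2  *)
  let NN := N *m adjq N in                    (* N N^*    *)
  let C1 := C *m adjq B1 in
  let C2 := C *m adjq N in
  let B2t := B2 *m adjq B1 in
  let C3 := adjq A2 *m C *m adjq N in
  let x11 := fun (i l : 'I_m) => sum_rdet AA r2 l (row i AA) in
  let x12 := fun (l : 'I_m) (t : 'I_q) => sum_rdet NN r4 t (row l C2) in
  let x13 := fun (t : 'I_q) (j : 'I_r) => sum_rdet BB r1 j (row t B2t) in
  let dA2 := fun g : 'I_p =>
    \row_(l < q) sum_cdet AsA r2 g (col l C3) in
  let dN := fun f : 'I_q =>
    \col_(k < p) sum_rdet NN r4 f (row k C3) in
  (forall (i : 'I_m) (j : 'I_r),
     X1 i j =
       sum_rdet BB r1 j (row i C1) * qinv (sum_minors BB r1)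
     - (\sum_(l < m) \sum_(t < q) x11 i l * x12 l t * x13 t j) *
       qinv (sum_minors AA r2 * sum_minors NN r4 * sum_minors BB r1)) /\
  (forall (g : 'I_p) (f : 'I_q),
     X2 g f = sum_rdet NN r4 f (dA2 g) *
              qinv (sum_minors AsA r2 * sum_minors NN r4) /\
     X2 g f = sum_cdet AsA r2 g (dN f) *
              qinv (sum_minors AsA r2 * sum_minors NN r4)).
Proof.
move=> rkB1 rkA2 _ MPB1 MPA2 N rkN MPN X1 X2 BB AA AsA NN C1 C2 B2t C3 x11 x12 x13 dA2 dN.
(* The rank criterion concerns [adjq A *m A]; equality of the minor sums moves it to
   [A *m adjq A]. *)
have rank0 m' n' (A : 'M[quat R]_(m', n')) k : has_rankq A k ->
    minors_sum (A *m adjq A) k != 0 /\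
    forall l, (k < l)%N -> minors_sum (A *m adjq A) l = 0.
  case/has_rankq_minors => e_gt0 e0; split.
    by rewrite (minors_sum_gram A k).1 gt_eqF.
  by move=> l /e0; rewrite (minors_sum_gram A l).1.
have [eB eB0] := rank0 _ _ _ _ rkB1; have [eA eA0] := rank0 _ _ _ _ rkA2.
have [eN eN0] := rank0 _ _ _ _ rkN.
have eAA0 l : (r2 < l)%N -> minors_sum AsA l = 0.
  by move=> /eA0; rewrite (minors_sum_gram A2 l).1.
have eAA : minors_sum AsA r2 != 0 by rewrite -(minors_sum_gram A2 r2).1.
have BE : sum_minors BB r1 = qreal (minors_sum BB r1).
  by rewrite sum_minorsE ?adjq_gramr.
have AE : sum_minors AA r2 = qreal (minors_sum AA r2).
  by rewrite sum_minorsE ?adjq_gramr.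
have NE : sum_minors NN r4 = qreal (minors_sum NN r4).
  by rewrite sum_minorsE ?adjq_gramr.
have AsE : sum_minors AsA r2 = qreal (minors_sum AsA r2).
  by rewrite sum_minorsE ?adjq_gram.
have divE (a : R) (x : quat R) : a != 0 -> qreal a * x * qinv (qreal a) = x.
  move=> a0; rewrite qinv_qreal qrealC mulrA -rmorphM mulVf // rmorph1.
  by rewrite mul1r.
split=> [i j|g f]; last split.
- rewrite BE AE NE -!rmorphM /BB /C1 (sum_rdet_MPinv _ _ _ MPB1 eB0) divE //.
  rewrite /X1 [LHS]mxE; congr (_ + _); rewrite [LHS]mxE; congr (- _).
  have nz : minors_sum AA r2 * minors_sum NN r4 * minors_sum BB r1 != 0.
    by rewrite !mulf_neq0.
  (* The three denominators are real, so their product is central and can be distributed over the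
     factors of each summand. *)
  rewrite -[LHS](divE _ _ nz); congr (_ * _).
  rewrite -!mulmxA [A2 *m (A2d *m _)]mulmxA mxE mulr_sumr; apply: eq_bigr => l _.
  rewrite [C *m _]mulmxA [(_ *m (B2 *m B1d)) l j]mxE 2!mulr_sumr; apply: eq_bigr => t _.
  rewrite /x11 /x12 /x13 (sum_rdet_MPinv _ _ _ MPA2 eA0).
  rewrite (sum_rdet_MPinv _ _ _ MPN eN0) (sum_rdet_MPinv _ _ _ MPB1 eB0).
  by rewrite !qrealMM; congr (_ * _); apply: mulrA.
(* The inner column sums form a row of a real multiple of [A2d *m C *m adjq N], to which the row
   formula applies in turn. *)
- have -> : dA2 g = row g ((qreal (minors_sum AsA r2) *: (A2d *m C)) *m adjq N).
    apply/matrixP => x l; rewrite (ord1 x) mxE [RHS]mxE /C3 -mulmxA.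
    by rewrite (sum_cdet_MPinv _ _ _ MPA2 eAA0) -scalemxAl [RHS]mxE mulmxA.
  rewrite (sum_rdet_MPinv _ _ _ MPN eN0) AsE NE -rmorphM -scalemxAl [in RHS]mxE mulrA.
  by rewrite -rmorphM /= [X in qreal X]mulrC divE ?mulf_neq0.
(* Dually, the inner row sums form a column to which the column formula applies. *)
have -> : dN f = col f (adjq A2 *m (qreal (minors_sum NN r4) *: (C *m Nd))).
  apply/matrixP => x y; rewrite (ord1 y) mxE [RHS]mxE /C3.
  by rewrite (sum_rdet_MPinv _ _ _ MPN eN0) mulmx_qscale [RHS]mxE mulmxA.
rewrite (sum_cdet_MPinv _ _ _ MPA2 eAA0) AsE NE -rmorphM mulmx_qscale [in RHS]mxE mulrA.
by rewrite -rmorphM divE ?mulf_neq0 // mulmxA.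
Qed.
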